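(* Let $\Omega\subset\mathbb{C}$ be a hyperbolic domain. Then the Hurwitz density $\eta_\Omega$ and the density $\overline{\eta}_\Omega$ are bi-Lipschitz equivalent in $\Omega$; precisely, for every $w\in\Omega$, $$\frac{\eta_\Omega(w)}{16}\leq\overline{\eta}_\Omega(w)\leq\eta_\Omega(w).$$ Moreover, the second inequality is sharp, i.e. there is no constant $c<1$ such that $\overline{\eta}_\Omega(w)\leq c\,\eta_\Omega(w)$ for all hyperbolic domains $\Omega\subset\mathbb{C}$ and all $w\in\Omega$.
   Context: A domain is a nonempty open connected subset of $\mathbb{C}$; a domain $\Omega\subset\mathbb{C}$ is hyperbolic if its complement $\Omega^c=\mathbb{C}\setminus\Omega$ contains at least two points. $\mathbb{D}=\{z\in\mathbb{C}:|z|<1\}$ and $\mathbb{D}^*=\mathbb{D}\setminus\{0\}$. Hurwitz density: for a domain $\Omega\subsetneq\mathbb{C}$ and $w\in\Omega$, let $\mathcal{H}_0^w(\mathbb{D},\Omega)$ be the collection of all holomorphic functions $f:\mathbb{D}\to\Omega$ such that $f(0)=w$, $f(s)\neq w$ for all $s\in\mathbb{D}^*$, and $f'(0)>0$. Put $r_\Omega(w)=\max\{f'(0): f\in\mathcal{H}_0^w(\mathbb{D},\Omega)\}$ (the maximum is known to exist) and $\eta_\Omega(w)=2/r_\Omega(w)$. For a hyperbolic domain $\Omega$ and $w\in\Omega$, $$\overline{\eta}_\Omega(w)=\sup\,\eta_{\mathbb{C}\setminus\{w_1,w_2\}}(w),$$ where the supremum is taken over all pairs of distinct points $w_1,w_2\in\Omega^c$.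 *)

(* Defs.v *)
From Stdlib Require Import Reals.
From Coquelicot Require Import Coquelicot.

Open Scope R_scope.

(* Connectedness of a subset of C: it is not covered by two open sets that
   both meet it but have no common point inside it. *)
Definition connected_set (A : C -> Prop) : Prop :=
  forall U V : C -> Prop,
    open U -> open V ->
    (forall z, A z -> U z \/ V z) ->
    (exists z, A z /\ U z) ->
    (exists z, A z /\ V z) ->
    exists z, A z /\ U z /\ V z.

Definition plane_domain (Om : C -> Prop) : Prop :=
  (exists z, Om z) /\ open Om /\ connected_set Om.

Definition hyperbolic (Om : C -> Prop) : Prop :=
  exists w1 w2 : C, w1 <> w2 /\ ~ Om w1 /\ ~ Om w2.

Definition unit_disc (z : C) : Prop := Cmod z < 1.

(* A function on the unit disc is represented by a total function on C of which
   only the restriction to the disc matters; [ex_derive] is taken over the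
   field [C_AbsRing], i.e. it is complex differentiability. *)
Definition holomorphic_on_disc (f : C -> C) : Prop :=
  forall z, unit_disc z ->
    ex_derive (K := C_AbsRing) (V := C_NormedModule) f z.

Definition has_derivative (f : C -> C) (z l : C) : Prop :=
  is_derive (K := C_AbsRing) (V := C_NormedModule) f z l.

(* The class H_0^w(D, Om); "f'(0) > 0" says that the complex number f'(0) is
   real and positive. *)
Definition hurwitz_class (Om : C -> Prop) (w : C) (f : C -> C) : Prop :=
  holomorphic_on_disc f /\
  (forall z, unit_disc z -> Om (f z)) /\
  f (RtoC 0) = w /\
  (forall s, unit_disc s -> s <> RtoC 0 -> f s <> w) /\
  (exists r : R, 0 < r /\ has_derivative f (RtoC 0) (RtoC r)).

Definition hurwitz_derivatives (Om : C -> Prop) (w : C) (r : R) : Prop :=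
  exists f, hurwitz_class Om w f /\ has_derivative f (RtoC 0) (RtoC r).

(* r_Om(w): the maximum of the derivatives, made a total function as the
   supremum in the extended reals; it is the maximum whenever that exists, by
   [hurwitz_radius_max] below. *)
Definition hurwitz_radius (Om : C -> Prop) (w : C) : Rbar :=
  Lub_Rbar (hurwitz_derivatives Om w).

Lemma hurwitz_radius_max (Om : C -> Prop) (w : C) (m : R) :
  hurwitz_derivatives Om w m ->
  (forall r, hurwitz_derivatives Om w r -> r <= m) ->
  hurwitz_radius Om w = Finite m.
Proof.
intros Hm Hmax; apply is_lub_Rbar_unique; split.
- intros r Hr; exact (Hmax r Hr).
- intros b Hb; exact (Hb m Hm).
Qed.

(* eta_Om(w) = 2 / r_Om(w), with the convention 2 / +oo = 0; [Rbar_inv] only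
   takes finite values, so no information is lost by the projection to R. *)
Definition hurwitz_density (Om : C -> Prop) (w : C) : R :=
  real (Rbar_div (Finite 2) (hurwitz_radius Om w)).

Definition twice_punctured_plane (w1 w2 z : C) : Prop :=
  z <> w1 /\ z <> w2.

(* The supremum is taken in the extended reals, so that it is meaningful
   without knowing beforehand that the set is bounded. *)
Definition hurwitz_density_bar (Om : C -> Prop) (w : C) : Rbar :=
  Lub_Rbar (fun x : R =>
    exists w1 w2 : C,
      w1 <> w2 /\ ~ Om w1 /\ ~ Om w2 /\
      x = hurwitz_density (twice_punctured_plane w1 w2) w).

(* Main.v *)
Require Import Defs.
From Stdlib Require Import ZArith Reals Ranalysis5 Lra Lia Psatz Classical ClassicalEpsilon.
From Coquelicot Require Import Coquelicot.
Open Scope R_scope.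

(** The two inequalities rest on Hurwitz's theorem with its sharp constant
    ([hurwitz_one_sixteenth]): if [f] is holomorphic on the unit disc, vanishes
    exactly at [0] and omits [1], then [|f'(0)| <= 16].  After an affine change
    it gives [r_Om(w) <= 16 |w1 - w|] for every omitted point [w1].  Hence each
    pair of omitted points [w1], [w2] contributes at least [1 / (8 |w1 - w|)] to
    the supremum, so a finite value [b] of the supremum keeps the complement at
    distance at least [d = 1 / (8 b)] from [w]; the map [z |-> w + d z] is then
    admissible for [Om] and [eta_Om(w) <= 2 / d = 16 b].  The second inequality
    is monotonicity of the admissible class, with equality when [Om] is itself a
    twice punctured plane, and there [eta] is positive, again because [r] is
    finite.

    Hurwitz's theorem is usually read off from the elliptic modular function.
    Here it comes from its functional equation, the Landen transformation.  Let
    [h] vanish exactly at [0] and omit the [N]-th roots of unity, and let [s] be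
    the square root of [1 - h^N] with [s(0) = 1].  Then [1 + s] has no zero and
    [h' = h / (1 + s)^(2/N)] satisfies [h'^N = (1 - s) / (1 + s)], a function
    that avoids [1] and [-1]; so [h'] omits the [2N]-th roots of unity, and its
    derivative at [0] is that of [h] times [4^(-1/N)] ([landen_step]).  Starting
    from [f] with [N = 1], the derivative after all steps has been divided by
    [4^(1 + 1/2 + 1/4 + ...) = 16].

    It remains to see that, for large [N], the iterate [h] maps a given smaller
    disc [|z| <= r] into the unit disc, for then Schwarz gives
    [|h'(0)| <= 1 / r], and [r] can tend to [1].  The iterates have a common
    bound on each circle, because one step increases [|ln |h||] by at
    most [(ln 6) / N] ([sqrt_branch_growth]).  Given such a bound, a function with
    [h(0) = 0] that omits a point [p] of the unit circle stays at a definite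
    distance from [p] on [|z| <= r], by the Harnack inequality for
    [ln (M / |h - p|)] ([omitted_value_distance]).  If [h] met the unit circle,
    it would come within [2 pi / N] of an omitted root of unity, which is
    impossible once [N] is large.

    The function theory is developed from complex differentiability alone:
    Goursat's theorem by bisection, applied to [F (z0 + e^zeta)] on a vertical
    strip, where periodicity cancels the horizontal sides, gives the mean value
    inequality; the maximum principle, the Schwarz lemma and the Harnack
    inequality follow from it. *)

(** * Complex differentiability at a point *)

Definition Ccont (f : C -> C) (z : C) : Prop :=
  forall e, 0 < e -> exists d, 0 < d /\
    forall w, Cmod (w - z) < d -> Cmod (f w - f z) < e.

(** Caratheodory's form of differentiability: the difference quotient extends
    continuously to the point.  Products, compositions and inverses then reduce
    to algebra on the quotients, and the quotient is itself the function to
    which the Schwarz lemma applies the maximum principle. *)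
Definition Cderiv (f : C -> C) (z l : C) : Prop :=
  exists q, Ccont q z /\ q z = l /\
    exists d, 0 < d /\ forall w, Cmod (w - z) < d -> (f w = f z + q w * (w - z))%C.

Lemma Ceq_sub0 (a b : C) : (a - b)%C = 0 -> a = b.
Proof. intros H. replace a with (a - b + b)%C by ring. rewrite H. ring. Qed.

Lemma Cmod_self0 (z : C) : Cmod (z - z) = 0.
Proof. replace (z - z)%C with (RtoC 0) by ring. apply Cmod_0. Qed.

Lemma Cmod_sub_sym (a b : C) : Cmod (a - b) = Cmod (b - a).
Proof. rewrite <- Cmod_opp. f_equal. ring. Qed.

Lemma Cmod_sub_triangle (a b c : C) : Cmod (a - c) <= Cmod (a - b) + Cmod (b - c).
Proof. replace (a - c)%C with ((a - b) + (b - c))%C by ring. apply Cmod_triangle. Qed.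

Lemma Cmod_rev_triangle (a b : C) : Cmod a - Cmod b <= Cmod (a - b).
Proof.
  assert (H := Cmod_triangle (a - b) b).
  replace (a - b + b)%C with a in H by ring. lra.
Qed.

Lemma Ccont_const (c z : C) : Ccont (fun _ => c) z.
Proof. intros e He. exists 1. split; [lra|]. intros. rewrite Cmod_self0. auto. Qed.

Lemma Ccont_id (z : C) : Ccont (fun w => w) z.
Proof. intros e He. exists e. auto. Qed.

Lemma Ccont_local (f g : C -> C) (z : C) (d : R) :
  0 < d -> (forall w, Cmod (w - z) < d -> f w = g w) -> Ccont g z -> Ccont f z.
Proof.
  intros Hd H Hg e He. destruct (Hg e He) as [d' [Hd' H']].
  exists (Rmin d d'). split; [now apply Rmin_pos|]. intros w Hw.
  assert (Rmin d d' <= d) by apply Rmin_l. assert (Rmin d d' <= d') by apply Rmin_r.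
  rewrite !H; [apply H'; lra| rewrite Cmod_self0; auto | lra].
Qed.

Lemma Ccont_plus (f g : C -> C) (z : C) :
  Ccont f z -> Ccont g z -> Ccont (fun w => f w + g w)%C z.
Proof.
  intros Hf Hg e He.
  destruct (Hf (e/2)) as [d1 [Hd1 H1]]; [lra|].
  destruct (Hg (e/2)) as [d2 [Hd2 H2]]; [lra|].
  exists (Rmin d1 d2). split; [now apply Rmin_pos|]. intros w Hw.
  assert (Rmin d1 d2 <= d1) by apply Rmin_l. assert (Rmin d1 d2 <= d2) by apply Rmin_r.
  replace (f w + g w - (f z + g z))%C with ((f w - f z) + (g w - g z))%C by ring.
  eapply Rle_lt_trans; [apply Cmod_triangle|].
  specialize (H1 w ltac:(lra)). specialize (H2 w ltac:(lra)). lra.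
Qed.

Lemma Ccont_mult (f g : C -> C) (z : C) :
  Ccont f z -> Ccont g z -> Ccont (fun w => f w * g w)%C z.
Proof.
  intros Hf Hg e He.
  set (A := Cmod (f z)). set (B := Cmod (g z)).
  assert (HA : 0 <= A) by apply Cmod_ge_0. assert (HB : 0 <= B) by apply Cmod_ge_0.
  set (k := Rmin 1 (e / (A + B + 2))).
  assert (Hk : 0 < k) by (apply Rmin_pos; [lra| apply Rdiv_lt_0_compat; lra]).
  assert (Hk1 : k <= 1) by apply Rmin_l.
  assert (Hk2 : k * (A + B + 2) <= e).
  { assert (k <= e / (A + B + 2)) by apply Rmin_r.
    apply Rle_trans with (e / (A + B + 2) * (A + B + 2)).
    - apply Rmult_le_compat_r; lra.
    - right. field. lra. }
  destruct (Hf k) as [d1 [Hd1 H1]]; [lra|].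
  destruct (Hg k) as [d2 [Hd2 H2]]; [lra|].
  exists (Rmin d1 d2). split; [now apply Rmin_pos|]. intros w Hw.
  assert (Rmin d1 d2 <= d1) by apply Rmin_l. assert (Rmin d1 d2 <= d2) by apply Rmin_r.
  replace (f w * g w - f z * g z)%C with
    ((f w - f z) * (g w - g z) + (f z * (g w - g z) + (f w - f z) * g z))%C by ring.
  specialize (H1 w ltac:(lra)). specialize (H2 w ltac:(lra)).
  eapply Rle_lt_trans; [apply Cmod_triangle|].
  eapply Rle_lt_trans; [apply Rplus_le_compat_l, Cmod_triangle|].
  rewrite !Cmod_mult. fold A B.
  assert (H3 := Cmod_ge_0 (f w - f z)). assert (H4 := Cmod_ge_0 (g w - g z)).
  nra.
Qed.

Lemma Ccont_comp (f g : C -> C) (z : C) :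
  Ccont f z -> Ccont g (f z) -> Ccont (fun w => g (f w)) z.
Proof.
  intros Hf Hg e He. destruct (Hg e He) as [d1 [Hd1 H1]].
  destruct (Hf d1 Hd1) as [d2 [Hd2 H2]]. exists d2. split; auto.
Qed.

Lemma Ccont_inv (z : C) : z <> 0 -> Ccont Cinv z.
Proof.
  intros Hz e He. assert (HA := proj1 (Cmod_gt_0 z) Hz). set (A := Cmod z) in *.
  exists (Rmin (A/2) (e * (A * A) / 2)). split.
  { apply Rmin_pos; [lra|]. assert (0 < A * A) by (apply Rmult_lt_0_compat; auto).
    assert (0 < e * (A * A)) by (apply Rmult_lt_0_compat; auto). lra. }
  intros w Hw.
  assert (L1 := Rmin_l (A/2) (e * (A * A) / 2)). assert (L2 := Rmin_r (A/2) (e * (A * A) / 2)).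
  assert (HB : A / 2 < Cmod w).
  { assert (H := Cmod_rev_triangle z w). rewrite Cmod_sub_sym in Hw. fold A in H. lra. }
  assert (Hw0 : w <> 0) by (apply Cmod_gt_0; lra).
  replace (/ w - / z)%C with (- (w - z) / (w * z))%C by (field; auto).
  rewrite Cmod_div by (apply Cmult_neq_0; auto).
  rewrite Cmod_opp, Cmod_mult. fold A.
  apply Rmult_lt_reg_r with (Cmod w * A); [nra|].
  replace (Cmod (w - z) / (Cmod w * A) * (Cmod w * A)) with (Cmod (w - z)) by (field; lra).
  apply Rlt_le_trans with (e * (A * A) / 2); [lra|].
  assert (0 < e * A) by nra. nra.
Qed.

Lemma Cderiv_cts (f : C -> C) (z l : C) : Cderiv f z l -> Ccont f z.
Proof.
  intros [q [Hq [_ [d [Hd H]]]]].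
  apply Ccont_local with (g := fun w => (f z + q w * (w + (- z)))%C) (d := d); auto.
  apply Ccont_plus; [apply Ccont_const|]. apply Ccont_mult; auto.
  apply Ccont_plus; [apply Ccont_id|apply Ccont_const].
Qed.

Lemma Cderiv_local (f g : C -> C) (z l : C) (d : R) :
  0 < d -> (forall w, Cmod (w - z) < d -> f w = g w) -> Cderiv g z l -> Cderiv f z l.
Proof.
  intros Hd H [q [Hq [Hl [d' [Hd' H']]]]]. exists q. do 2 (split; auto).
  exists (Rmin d d'). split; [now apply Rmin_pos|]. intros w Hw.
  assert (Rmin d d' <= d) by apply Rmin_l. assert (Rmin d d' <= d') by apply Rmin_r.
  rewrite !H; [apply H'; lra| rewrite Cmod_self0; auto | lra].
Qed.

Lemma Cderiv_const (c z : C) : Cderiv (fun _ => c) z 0.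
Proof.
  exists (fun _ => RtoC 0). split; [apply Ccont_const|]. split; auto.
  exists 1. split; [lra|]. intros. ring.
Qed.

Lemma Cderiv_id (z : C) : Cderiv (fun w => w) z 1.
Proof.
  exists (fun _ => RtoC 1). split; [apply Ccont_const|]. split; auto.
  exists 1. split; [lra|]. intros. ring.
Qed.

Lemma Cderiv_plus (f g : C -> C) (z l m : C) :
  Cderiv f z l -> Cderiv g z m -> Cderiv (fun w => f w + g w)%C z (l + m).
Proof.
  intros [q [Hq [Hl [d [Hd H]]]]] [q' [Hq' [Hl' [d' [Hd' H']]]]].
  exists (fun w => q w + q' w)%C. split; [now apply Ccont_plus|]. split; [congruence|].
  exists (Rmin d d'). split; [now apply Rmin_pos|]. intros w Hw.
  assert (Rmin d d' <= d) by apply Rmin_l. assert (Rmin d d' <= d') by apply Rmin_r.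
  rewrite (H w), (H' w) by lra. ring.
Qed.

Lemma Cderiv_mult (f g : C -> C) (z l m : C) :
  Cderiv f z l -> Cderiv g z m -> Cderiv (fun w => f w * g w)%C z (l * g z + f z * m).
Proof.
  intros Hf Hg. assert (Cf := Cderiv_cts _ _ _ Hf).
  destruct Hf as [q [Hq [Hl [d [Hd H]]]]], Hg as [q' [Hq' [Hl' [d' [Hd' H']]]]].
  exists (fun w => q w * g z + f w * q' w)%C. split.
  { apply Ccont_plus; apply Ccont_mult; auto. apply Ccont_const. }
  split; [congruence|].
  exists (Rmin d d'). split; [now apply Rmin_pos|]. intros w Hw.
  assert (Rmin d d' <= d) by apply Rmin_l. assert (Rmin d d' <= d') by apply Rmin_r.
  rewrite (H' w) by lra. rewrite (H w) by lra. ring.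
Qed.

Lemma Cderiv_comp (f g : C -> C) (z l m : C) :
  Cderiv f z l -> Cderiv g (f z) m -> Cderiv (fun w => g (f w)) z (m * l).
Proof.
  intros Hf Hg. assert (Cf := Cderiv_cts _ _ _ Hf).
  destruct Hf as [q [Hq [Hl [d [Hd H]]]]], Hg as [q' [Hq' [Hl' [d' [Hd' H']]]]].
  destruct (Cf d' Hd') as [d2 [Hd2 H2]].
  exists (fun w => q' (f w) * q w)%C. split.
  { apply Ccont_mult; auto. apply (Ccont_comp f q'); auto. }
  split; [congruence|].
  exists (Rmin d d2). split; [now apply Rmin_pos|]. intros w Hw.
  assert (Rmin d d2 <= d) by apply Rmin_l. assert (Rmin d d2 <= d2) by apply Rmin_r.
  rewrite (H' (f w)) by (apply H2; lra). rewrite (H w) at 2 by lra. ring.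
Qed.

Lemma Cderiv_inv (z : C) : z <> 0 -> Cderiv Cinv z (- / (z * z)).
Proof.
  intros Hz. assert (HA := proj1 (Cmod_gt_0 z) Hz).
  exists (fun w => (- / z) * / w)%C. split.
  { apply Ccont_mult; [apply Ccont_const|now apply Ccont_inv]. }
  split; [field; auto|].
  exists (Cmod z). split; auto. intros w Hw.
  assert (w <> 0). { intros ->. rewrite Cmod_sub_sym in Hw.
    replace (z - 0)%C with z in Hw by ring. lra. }
  field. auto.
Qed.

Definition Cderivable (f : C -> C) (z : C) : Prop := exists l, Cderiv f z l.

Lemma Cderivable_cts f z : Cderivable f z -> Ccont f z.
Proof. intros [l H]. eapply Cderiv_cts; eauto. Qed.
Lemma Cderivable_const c z : Cderivable (fun _ => c) z.
Proof. exists 0. apply Cderiv_const. Qed.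
Lemma Cderivable_id z : Cderivable (fun w => w) z.
Proof. exists 1. apply Cderiv_id. Qed.
Lemma Cderivable_plus f g z : Cderivable f z -> Cderivable g z -> Cderivable (fun w => f w + g w)%C z.
Proof. intros [l H] [m H']. eexists. apply Cderiv_plus; eauto. Qed.
Lemma Cderivable_mult f g z : Cderivable f z -> Cderivable g z -> Cderivable (fun w => f w * g w)%C z.
Proof. intros [l H] [m H']. eexists. apply Cderiv_mult; eauto. Qed.
Lemma Cderivable_comp f g z : Cderivable f z -> Cderivable g (f z) -> Cderivable (fun w => g (f w)) z.
Proof. intros [l H] [m H']. eexists. apply (Cderiv_comp f g); eauto. Qed.
Lemma Cderivable_opp f z : Cderivable f z -> Cderivable (fun w => - f w)%C z.
Proof.
  intros H. destruct (Cderivable_mult (fun _ => (- RtoC 1)%C) f z (Cderivable_const _ _) H) as [l Hl].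
  exists l. eapply Cderiv_local; [apply Rlt_0_1| |exact Hl]. intros w _. simpl. ring.
Qed.
Lemma Cderivable_minus f g z : Cderivable f z -> Cderivable g z -> Cderivable (fun w => f w - g w)%C z.
Proof. intros Hf Hg. apply (Cderivable_plus f (fun w => - g w)%C); auto. now apply Cderivable_opp. Qed.
Lemma Cderivable_inv f z : Cderivable f z -> f z <> 0 -> Cderivable (fun w => / f w)%C z.
Proof. intros Hf H. apply (Cderivable_comp f Cinv); auto. eexists. now apply Cderiv_inv. Qed.
Lemma Cderivable_div f g z : Cderivable f z -> Cderivable g z -> g z <> 0 -> Cderivable (fun w => f w / g w)%C z.
Proof. intros Hf Hg H. apply (Cderivable_mult f (fun w => / g w)%C); auto. now apply Cderivable_inv. Qed.
Lemma Cderivable_pow f z n : Cderivable f z -> Cderivable (fun w => f w ^ n)%C z.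
Proof. intros Hf. induction n; simpl. apply Cderivable_const. now apply Cderivable_mult. Qed.
Lemma Cderivable_local f g z d :
  0 < d -> (forall w, Cmod (w - z) < d -> f w = g w) -> Cderivable g z -> Cderivable f z.
Proof. intros Hd H [l Hl]. exists l. eapply Cderiv_local; eauto. Qed.

Lemma Cderiv_intro (f : C -> C) (z l : C) :
  (forall e, 0 < e -> exists d, 0 < d /\ forall w, Cmod (w - z) < d ->
     Cmod (f w - f z - l * (w - z)) <= e * Cmod (w - z)) -> Cderiv f z l.
Proof.
  intros H.
  exists (fun w => if excluded_middle_informative (w = z) then l else ((f w - f z) / (w - z))%C).
  destruct (excluded_middle_informative (z = z)) as [_|K]; [|now destruct K].
  split; [|split; auto].
  - intros e He. destruct (H (e / 2)) as [d [Hd K]]; [lra|]. exists d. split; auto. intros w Hw.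
    destruct (excluded_middle_informative (z = z)) as [_|K0]; [|now destruct K0].
    destruct (excluded_middle_informative (w = z)) as [->|N]; [rewrite Cmod_self0; auto|].
    assert (N' : (w - z)%C <> 0) by (intros E; now apply N, Ceq_sub0).
    assert (P : 0 < Cmod (w - z)) by now apply Cmod_gt_0.
    specialize (K w Hw).
    replace ((f w - f z) / (w - z) - l)%C with ((f w - f z - l * (w - z)) / (w - z))%C
      by (field; auto).
    rewrite Cmod_div by auto. apply Rle_lt_trans with (e / 2); [|lra].
    apply Rmult_le_reg_r with (Cmod (w - z)); auto.
    unfold Rdiv at 1. rewrite Rmult_assoc, Rinv_l, Rmult_1_r; lra.
  - exists 1. split; [lra|]. intros w _.
    destruct (excluded_middle_informative (w = z)) as [->|N]; [ring|].
    field. intros E. now apply N, Ceq_sub0.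
Qed.

Lemma Cderiv_of_is_derive (f : C -> C) (z l : C) :
  is_derive (K := C_AbsRing) (V := C_NormedModule) f z l -> Cderiv f z l.
Proof.
  intros [_ H]. specialize (H z (fun P HP => HP)). apply Cderiv_intro. intros e He.
  destruct (H (mkposreal e He)) as [d Hd]. exists d. split; [apply cond_pos|]. intros w Hw.
  rewrite (Cmult_comm l). exact (Hd w Hw).
Qed.

(** * Bisection of rectangles and compactness of discs *)

Lemma nested_intervals (x : nat -> R) (A : R) :
  0 <= A ->
  (forall n, x n <= x (S n) /\ x (S n) + A / 2 ^ S n <= x n + A / 2 ^ n) ->
  exists xs, forall n, x n <= xs <= x n + A / 2 ^ n.
Proof.
  intros HA H.
  assert (P : forall n, 0 <= A / 2 ^ n).
  { intros n. apply Rdiv_le_0_compat; auto. apply pow_lt. lra. }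
  assert (Up : forall n k, x n <= x (n + k)%nat /\ x (n + k)%nat + A / 2 ^ (n + k) <= x n + A / 2 ^ n).
  { intros n k. induction k.
    - rewrite Nat.add_0_r. lra.
    - rewrite Nat.add_succ_r. destruct (H (n + k)%nat). lra. }
  assert (All : forall n m, x m <= x n + A / 2 ^ n).
  { intros n m. destruct (Nat.le_ge_cases n m) as [L|L].
    - replace m with (n + (m - n))%nat by lia. specialize (P (n + (m - n))%nat).
      destruct (Up n (m - n)%nat). lra.
    - destruct (Up m (n - m)%nat) as [U _]. replace (m + (n - m))%nat with n in U by lia.
      specialize (P n). lra. }
  destruct (completeness (fun r => exists n, r = x n)) as [xs [Hub Hl]].
  - exists (x O + A / 2 ^ O). intros r [n ->]. apply All.
  - exists (x O). now exists O.
  - exists xs. intros n. split.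
    + apply Hub. now exists n.
    + apply Hl. intros r [m ->]. apply All.
Qed.

(** The common core of Goursat's theorem and of compactness: a property of
    cells that passes to one of the four quarters is found on arbitrarily small
    cells around one point.  Cells are given by their lower left corner and
    their generation [n]. *)
Lemma bisection (Bad : R -> R -> nat -> Prop) (A B x0 y0 : R) :
  0 <= A -> 0 <= B -> Bad x0 y0 O ->
  (forall x y n, Bad x y n -> exists i j,
     (i = 0 \/ i = A / 2 ^ S n) /\ (j = 0 \/ j = B / 2 ^ S n) /\ Bad (x + i) (y + j) (S n)) ->
  exists xs ys, forall n, exists x y, Bad x y n /\
    x <= xs <= x + A / 2 ^ n /\ y <= ys <= y + B / 2 ^ n /\
    x0 <= x /\ x + A / 2 ^ n <= x0 + A /\ y0 <= y /\ y + B / 2 ^ n <= y0 + B.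
Proof.
  intros HA HB H0 Step.
  assert (St : forall n (p : {p : R * R | Bad (fst p) (snd p) n}),
    exists p' : {p : R * R | Bad (fst p) (snd p) (S n)},
      (fst (proj1_sig p') = fst (proj1_sig p) \/
       fst (proj1_sig p') = fst (proj1_sig p) + A / 2 ^ S n) /\
      (snd (proj1_sig p') = snd (proj1_sig p) \/
       snd (proj1_sig p') = snd (proj1_sig p) + B / 2 ^ S n)).
  { intros n [[x y] HP]. simpl in HP.
    destruct (Step x y n HP) as [i [j [Hi [Hj Hb]]]].
    exists (exist (fun p : R * R => Bad (fst p) (snd p) (S n)) (x + i, y + j) Hb).
    cbn [fst snd proj1_sig]. split.
    - destruct Hi as [->| ->]; [left; ring|right; reflexivity].
    - destruct Hj as [->| ->]; [left; ring|right; reflexivity]. }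
  set (next := fun n p => proj1_sig (constructive_indefinite_description _ (St n p))).
  set (sq := fix sq (n : nat) : {p : R * R | Bad (fst p) (snd p) n} :=
    match n with O => exist (fun p : R * R => Bad (fst p) (snd p) O) (x0, y0) H0
    | S m => next m (sq m) end).
  set (x := fun n => fst (proj1_sig (sq n))). set (y := fun n => snd (proj1_sig (sq n))).
  assert (Hb : forall n, Bad (x n) (y n) n) by (intros n; exact (proj2_sig (sq n))).
  assert (Hs : forall n, (x (S n) = x n \/ x (S n) = x n + A / 2 ^ S n) /\
                         (y (S n) = y n \/ y (S n) = y n + B / 2 ^ S n)).
  { intros n. exact (proj2_sig (constructive_indefinite_description _ (St n (sq n)))). }
  assert (half : forall c n, 0 <= c -> c / 2 ^ n = 2 * (c / 2 ^ S n) /\ 0 <= c / 2 ^ S n).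
  { intros c n Hc. split.
    - simpl. field. apply pow_nonzero. lra.
    - apply Rdiv_le_0_compat; auto. apply pow_lt; lra. }
  assert (Nx : forall n, x n <= x (S n) /\ x (S n) + A / 2 ^ S n <= x n + A / 2 ^ n).
  { intros n. destruct (half A n HA). destruct (Hs n) as [[->| ->] _]; lra. }
  assert (Ny : forall n, y n <= y (S n) /\ y (S n) + B / 2 ^ S n <= y n + B / 2 ^ n).
  { intros n. destruct (half B n HB). destruct (Hs n) as [_ [->| ->]]; lra. }
  destruct (nested_intervals x A HA Nx) as [xs Hxs].
  destruct (nested_intervals y B HB Ny) as [ys Hys].
  exists xs, ys. intros n. exists (x n), (y n).
  split; auto. split; auto. split; auto.
  assert (Bx : x0 <= x n /\ x n + A / 2 ^ n <= x0 + A).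
  { induction n. change (x O) with x0. simpl. split; lra. destruct IHn, (Nx n); split; lra. }
  assert (By : y0 <= y n /\ y n + B / 2 ^ n <= y0 + B).
  { clear Bx. induction n. change (y O) with y0. simpl. split; lra. destruct IHn, (Ny n); split; lra. }
  tauto.
Qed.

Lemma small_pow (c e : R) : 0 < e -> exists n, c / 2 ^ n < e.
Proof.
  intros He. destruct (Rle_or_lt c 0) as [Hc|Hc].
  - exists O. simpl. lra.
  - destruct (pow_lt_1_zero (1/2)) with (y := e / c) as [N HN].
    + rewrite Rabs_pos_eq; lra.
    + apply Rdiv_lt_0_compat; auto.
    + exists N. specialize (HN N (Nat.le_refl _)).
      rewrite Rabs_pos_eq in HN by (apply pow_le; lra).
      apply Rmult_lt_compat_l with (r := c) in HN; auto.
      replace (c * (e / c)) with e in HN by (field; lra).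
      replace (c / 2 ^ N) with (c * (1/2) ^ N); auto.
      unfold Rdiv at 1. rewrite Rmult_1_l, pow_inv. reflexivity.
Qed.

Lemma Cmod_le_abs (x y : R) : Cmod (x, y) <= Rabs x + Rabs y.
Proof.
  replace (x, y) with (RtoC x + Ci * RtoC y)%C.
  - eapply Rle_trans; [apply Cmod_triangle|].
    rewrite Cmod_mult, Cmod_Ci, !Cmod_R. lra.
  - unfold Cplus, Cmult, Ci, RtoC; simpl. f_equal; ring.
Qed.

(** Compactness of the closed disc in the form in which it is used: a bound that
    exists locally exists uniformly.  By bisection, otherwise no bound would
    hold near some point of the disc. *)
Lemma disc_compact (Good : C -> R -> Prop) (r : R) :
  (forall z b b', b <= b' -> Good z b -> Good z b') ->
  (forall z, Cmod z <= r -> exists d b, 0 < d /\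
     forall z', Cmod z' <= r -> Cmod (z' - z) < d -> Good z' b) ->
  exists b, forall z, Cmod z <= r -> Good z b.
Proof.
  intros Mono Loc. apply NNPP. intros Neg.
  destruct (Rlt_or_le r 0) as [Hr|Hr].
  { apply Neg. exists 0. intros z Hz. assert (K := Cmod_ge_0 z). lra. }
  set (Bad := fun x y n => forall b, exists z : C, Cmod z <= r /\ ~ Good z b /\
     x <= fst z <= x + (2 * r) / 2 ^ n /\ y <= snd z <= y + (2 * r) / 2 ^ n).
  destruct (bisection Bad (2 * r) (2 * r) (- r) (- r)) as [xs [ys Hs]]; try lra.
  - intros b. apply NNPP. intros K. apply Neg. exists b. intros z Hz.
    apply NNPP. intros K'. apply K. exists z. do 2 (split; auto).
    assert (L := Rmax_Cmod z). assert (L1 := Rmax_l (Rabs (fst z)) (Rabs (snd z))).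
    assert (L2 := Rmax_r (Rabs (fst z)) (Rabs (snd z))).
    assert (M1 : Rabs (fst z) <= r) by lra. assert (M2 : Rabs (snd z) <= r) by lra.
    apply Rabs_le_between in M1. apply Rabs_le_between in M2. simpl. lra.
  - intros x y n HB. apply NNPP. intros K.
    set (s := 2 * r / 2 ^ S n) in *.
    assert (Es : 2 * r / 2 ^ n = 2 * s) by (unfold s; simpl; field; apply pow_nonzero; lra).
    assert (Sub : forall i j, (i = 0 \/ i = s) -> (j = 0 \/ j = s) ->
       exists b, forall z : C, Cmod z <= r ->
         x + i <= fst z <= x + i + s -> y + j <= snd z <= y + j + s -> Good z b).
    { intros i j Hi Hj. apply NNPP. intros K'. apply K. exists i, j. do 2 (split; auto).
      intros b. apply NNPP. intros K2. apply K'. exists b. intros z Hz H1 H2.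
      apply NNPP. intros K3. apply K2. exists z. auto. }
    destruct (Sub 0 0) as [b1 G1]; auto. destruct (Sub s 0) as [b2 G2]; auto.
    destruct (Sub 0 s) as [b3 G3]; auto. destruct (Sub s s) as [b4 G4]; auto.
    destruct (HB (Rmax (Rmax b1 b2) (Rmax b3 b4))) as [z [Hz [Hg [Hx Hy]]]].
    rewrite Es in Hx, Hy. apply Hg.
    assert (M1 := Rmax_l b1 b2). assert (M2 := Rmax_r b1 b2).
    assert (M3 := Rmax_l b3 b4). assert (M4 := Rmax_r b3 b4).
    assert (M5 := Rmax_l (Rmax b1 b2) (Rmax b3 b4)).
    assert (M6 := Rmax_r (Rmax b1 b2) (Rmax b3 b4)).
    destruct (Rle_or_lt (fst z) (x + s)), (Rle_or_lt (snd z) (y + s)).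
    + apply Mono with b1; [lra|]. apply G1; auto; lra.
    + apply Mono with b3; [lra|]. apply G3; auto; lra.
    + apply Mono with b2; [lra|]. apply G2; auto; lra.
    + apply Mono with b4; [lra|]. apply G4; auto; lra.
  - set (zs := (xs, ys) : C).
    assert (Near : forall n (z : C) x y, x <= fst z <= x + 2 * r / 2 ^ n ->
       y <= snd z <= y + 2 * r / 2 ^ n -> x <= xs <= x + 2 * r / 2 ^ n ->
       y <= ys <= y + 2 * r / 2 ^ n -> Cmod (z - zs) <= 4 * r / 2 ^ n).
    { intros n [u v] x y. simpl. intros.
      replace (Cminus (u, v) zs) with (u - xs, v - ys) by reflexivity.
      eapply Rle_trans; [apply Cmod_le_abs|].
      replace (4 * r / 2 ^ n) with (2 * r / 2 ^ n + 2 * r / 2 ^ n)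
        by (field; apply pow_nonzero; lra).
      apply Rplus_le_compat; apply Rabs_le; lra. }
    assert (Hzs : Cmod zs <= r).
    { apply Rnot_lt_le. intros Hlt.
      destruct (small_pow (4 * r) (Cmod zs - r)) as [n Hn]; [lra|].
      destruct (Hs n) as [x [y [HB [Hx [Hy _]]]]].
      destruct (HB 0) as [z [Hz [_ [Hzx Hzy]]]].
      specialize (Near n z x y Hzx Hzy Hx Hy).
      assert (K := Cmod_rev_triangle zs z). rewrite Cmod_sub_sym in K. lra. }
    destruct (Loc zs Hzs) as [d [b [Hd HG]]].
    destruct (small_pow (4 * r) d Hd) as [n Hn].
    destruct (Hs n) as [x [y [HB [Hx [Hy _]]]]].
    destruct (HB b) as [z [Hz [Hng [Hzx Hzy]]]].
    apply Hng, HG; auto. eapply Rle_lt_trans; [|exact Hn]. eapply Near; eauto.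
Qed.

(** If the supremum [m] were not attained, [1 / (m - F)] would be locally bounded,
    hence bounded, and [m] would not be the least upper bound. *)
Lemma disc_max (F : C -> R) (r : R) :
  0 <= r ->
  (forall z, Cmod z <= r -> forall e, 0 < e -> exists d, 0 < d /\
     forall w, Cmod w <= r -> Cmod (w - z) < d -> Rabs (F w - F z) < e) ->
  exists z, Cmod z <= r /\ forall w, Cmod w <= r -> F w <= F z.
Proof.
  intros Hr Hc.
  destruct (disc_compact (fun z b => F z <= b) r) as [b Hb].
  { intros; lra. }
  { intros z Hz. destruct (Hc z Hz 1) as [d [Hd H]]; [lra|].
    exists d, (F z + 1). split; auto. intros z' Hz' Hn.
    specialize (H z' Hz' Hn). apply Rabs_lt_between in H. lra. }
  destruct (completeness (fun v => exists z, Cmod z <= r /\ v = F z)) as [m [Hub Hl]].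
  { exists b. intros v [z [Hz ->]]. auto. }
  { exists (F 0). exists (RtoC 0). rewrite Cmod_0. auto. }
  apply NNPP. intros K.
  assert (Lt : forall z, Cmod z <= r -> F z < m).
  { intros z Hz. apply Rnot_le_lt. intros L. apply K. exists z. split; auto.
    intros w Hw. apply Rle_trans with m; auto. apply Hub. exists w; auto. }
  destruct (disc_compact (fun z b => / (m - F z) <= b) r) as [c Hcb].
  { intros; lra. }
  { intros z Hz. specialize (Lt z Hz) as Lz.
    destruct (Hc z Hz ((m - F z) / 2)) as [d [Hd H]]; [lra|].
    exists d, (/ ((m - F z) / 2)). split; auto. intros z' Hz' Hn.
    specialize (H z' Hz' Hn). apply Rabs_lt_between in H.
    apply Rinv_le_contravar; lra. }
  assert (Hc0 : 0 < c).
  { specialize (Hcb 0). rewrite Cmod_0 in Hcb. specialize (Hcb Hr).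
    specialize (Lt 0). rewrite Cmod_0 in Lt. specialize (Lt Hr).
    apply Rlt_le_trans with (/ (m - F 0)); auto. apply Rinv_0_lt_compat. lra. }
  assert (m <= m - / c).
  { apply Hl. intros v [z [Hz ->]]. specialize (Hcb z Hz). specialize (Lt z Hz).
    apply Rinv_le_contravar in Hcb; [|apply Rinv_0_lt_compat; lra].
    rewrite Rinv_inv in Hcb. lra. }
  assert (0 < / c) by now apply Rinv_0_lt_compat. lra.
Qed.

(** * Goursat's theorem for closed 1-forms in the plane *)

(** First order expansion of [P] at [(x, y)], with partial derivatives [a] and [b];
    no regularity of the derivatives is implied. *)
Definition jet (P : R -> R -> R) (x y a b : R) : Prop :=
  forall e, 0 < e -> exists d, 0 < d /\ forall x' y',
    Rabs (x' - x) < d -> Rabs (y' - y) < d ->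
    Rabs (P x' y' - P x y - a * (x' - x) - b * (y' - y)) <= e * (Rabs (x' - x) + Rabs (y' - y)).

Lemma jet_cts_h P x y a b : jet P x y a b -> continuous (fun t => P t y) x.
Proof.
  intros H. apply continuity_pt_filterlim. intros e He.
  destruct (H 1) as [d [Hd K]]; [lra|].
  set (c := Rabs a + 1). assert (Hc : 0 < c) by (unfold c; assert (U := Rabs_pos a); lra).
  exists (Rmin d (e / c)). split; [apply Rmin_pos; auto; now apply Rdiv_lt_0_compat|].
  intros x' [_ Hx]. simpl in *. unfold R_dist in *.
  assert (L1 := Rmin_l d (e/c)). assert (L2 := Rmin_r d (e/c)).
  specialize (K x' y). rewrite !(Rminus_diag y), Rabs_R0 in K.
  specialize (K ltac:(lra) ltac:(lra)). rewrite Rmult_0_r, Rminus_0_r in K.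
  apply Rle_lt_trans with (c * Rabs (x' - x)).
  - replace (P x' y - P x y) with ((P x' y - P x y - a * (x' - x)) + a * (x' - x)) by ring.
    eapply Rle_trans; [apply Rabs_triang|]. rewrite Rabs_mult. unfold c. lra.
  - apply Rlt_le_trans with (c * (e / c)); [apply Rmult_lt_compat_l; lra|].
    right. field. lra.
Qed.

Lemma jet_cts_v P x y a b : jet P x y a b -> continuous (fun t => P x t) y.
Proof.
  intros H. apply (jet_cts_h (fun s t => P t s) y x b a).
  intros e He. destruct (H e He) as [d [Hd K]]. exists d. split; auto. intros x' y' H1 H2.
  replace (P y' x' - P x y - b * (x' - y) - a * (y' - x)) with
    (P y' x' - P x y - a * (y' - x) - b * (x' - y)) by ring.
  rewrite (Rplus_comm (Rabs (x' - y))). auto.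
Qed.

Lemma RInt_diff_bound (f g : R -> R) (a b k e : R) :
  a <= b -> ex_RInt f a b -> ex_RInt g a b ->
  (forall t, a < t < b -> Rabs (f t - g t - k) <= e) ->
  Rabs (RInt f a b - RInt g a b - k * (b - a)) <= e * (b - a).
Proof.
  intros Hab Hf Hg H.
  assert (E : RInt f a b - RInt g a b = RInt (fun t => f t - g t) a b).
  { symmetry. apply (RInt_minus f g a b Hf Hg). }
  assert (Ex : ex_RInt (fun t => f t - g t) a b) by (apply (ex_RInt_minus f g); auto).
  rewrite E. clear E.
  assert (C1 : forall c, RInt (fun _ => c) a b = c * (b - a)).
  { intros c. rewrite RInt_const. unfold scal; simpl. unfold mult; simpl. ring. }
  apply Rabs_le. split.
  - assert (RInt (fun _ => k - e) a b <= RInt (fun t => f t - g t) a b).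
    { apply RInt_le; auto. apply ex_RInt_const. intros t Ht.
      specialize (H t Ht). apply Rabs_le_between in H. lra. }
    rewrite C1 in H0. lra.
  - assert (RInt (fun t => f t - g t) a b <= RInt (fun _ => k + e) a b).
    { apply RInt_le; auto. apply ex_RInt_const. intros t Ht.
      specialize (H t Ht). apply Rabs_le_between in H. lra. }
    rewrite C1 in H0. lra.
Qed.

(** Circulation of the form [P dx + Q dy] around a rectangle with lower left
    corner [(x, y)], width [w] and height [h]. *)
Definition circulation (P Q : R -> R -> R) (x y w h : R) : R :=
  RInt (fun t => Q (x + w) t) y (y + h) - RInt (fun t => Q x t) y (y + h)
  - (RInt (fun t => P t (y + h)) x (x + w) - RInt (fun t => P t y) x (x + w)).

(** The affine parts of [P] and [Q] contribute nothing, since the cross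
    derivatives agree (both are [b]); the remainders contribute at most their
    size times the perimeter. *)
Lemma circulation_small P Q x y w h xs ys a b c e d :
  (forall t u v, u < x + w + d -> v < x + w + d -> ex_RInt (fun s => P s t) u v) ->
  (forall t u v, t < x + w + d -> ex_RInt (fun s => Q t s) u v) ->
  0 < e -> 0 < d -> 0 <= w -> 0 <= h -> w < d -> h < d ->
  x <= xs <= x + w -> y <= ys <= y + h ->
  (forall x' y', Rabs (x' - xs) < d -> Rabs (y' - ys) < d ->
    Rabs (P x' y' - P xs ys - a * (x' - xs) - b * (y' - ys)) <= e * (Rabs (x' - xs) + Rabs (y' - ys))) ->
  (forall x' y', Rabs (x' - xs) < d -> Rabs (y' - ys) < d ->
    Rabs (Q x' y' - Q xs ys - b * (x' - xs) - c * (y' - ys)) <= e * (Rabs (x' - xs) + Rabs (y' - ys))) ->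
  Rabs (circulation P Q x y w h) <= 2 * e * (w + h) ^ 2.
Proof.
  intros EP EQ He Hd Hw Hh Hwd Hhd Hx Hy HP HQ.
  assert (B : forall x' y', x <= x' <= x + w -> y <= y' <= y + h ->
     Rabs (x' - xs) < d /\ Rabs (y' - ys) < d /\
     e * (Rabs (x' - xs) + Rabs (y' - ys)) <= e * (w + h)).
  { intros x' y' H1 H2. repeat split; try (apply Rabs_lt_between; lra).
    apply Rmult_le_compat_l; [lra|]. apply Rplus_le_compat; apply Rabs_le; lra. }
  unfold circulation.
  assert (I1 : Rabs (RInt (fun t => Q (x + w) t) y (y + h) - RInt (fun t => Q x t) y (y + h)
     - (b * w) * (y + h - y)) <= 2 * e * (w + h) * (y + h - y)).
  { apply RInt_diff_bound; try (apply EQ; lra); [lra|]. intros t Ht.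
    destruct (B (x + w) t) as [A1 [A2 A3]]; try lra.
    destruct (B x t) as [A4 [A5 A6]]; try lra.
    specialize (HQ (x + w) t A1 A2) as K1. specialize (HQ x t A4 A5) as K2.
    apply Rabs_le_between in K1. apply Rabs_le_between in K2. apply Rabs_le. lra. }
  assert (I2 : Rabs (RInt (fun t => P t (y + h)) x (x + w) - RInt (fun t => P t y) x (x + w)
     - (b * h) * (x + w - x)) <= 2 * e * (w + h) * (x + w - x)).
  { apply RInt_diff_bound; try (apply EP; lra); [lra|]. intros t Ht.
    destruct (B t (y + h)) as [A1 [A2 A3]]; try lra.
    destruct (B t y) as [A4 [A5 A6]]; try lra.
    specialize (HP t (y + h) A1 A2) as K1. specialize (HP t y A4 A5) as K2.
    apply Rabs_le_between in K1. apply Rabs_le_between in K2. apply Rabs_le. lra. }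
  apply Rabs_le_between in I1. apply Rabs_le_between in I2. apply Rabs_le. 
  replace (y + h - y) with h in I1 by ring. replace (x + w - x) with w in I2 by ring. simpl. nra.
Qed.

(** A nonzero circulation would, by bisection, persist at scale [4^(-n)] on cells
    shrinking to a point, against the bound [e * 4^(-n)] given there by
    differentiability. *)
Lemma goursat (P Q : R -> R -> R) (X : R) :
  (forall x y, x < X -> exists a b c, jet P x y a b /\ jet Q x y b c) ->
  forall x0 y0 w h, 0 <= w -> 0 <= h -> x0 + w < X -> circulation P Q x0 y0 w h = 0.
Proof.
  intros HJ x0 y0 w h Hw Hh HX.
  assert (EP : forall t u v, u < X -> v < X -> ex_RInt (fun s => P s t) u v).
  { intros t u v Hu Hv. apply (ex_RInt_continuous (V := R_CompleteNormedModule)). intros z Hz.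
    destruct (HJ z t) as [a [b [c [H1 _]]]]. assert (Rmax u v < X) by now apply Rmax_lub_lt. lra.
    eapply jet_cts_h; eauto. }
  assert (EQ : forall t u v, t < X -> ex_RInt (fun s => Q t s) u v).
  { intros t u v Ht. apply (ex_RInt_continuous (V := R_CompleteNormedModule)). intros z Hz.
    destruct (HJ t z) as [a [b [c [_ H1]]]]; auto. eapply jet_cts_v; eauto. }
  set (eta := Rabs (circulation P Q x0 y0 w h)).
  assert (Heta : 0 <= eta) by apply Rabs_pos.
  destruct (Req_dec eta 0) as [E|NE].
  { unfold eta in E. destruct (Req_dec (circulation P Q x0 y0 w h) 0); auto.
    now apply Rabs_no_R0 in H. }
  exfalso.
  set (Bad := fun x y n => x0 <= x /\ x + w / 2 ^ n <= x0 + w /\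
     eta / 4 ^ n <= Rabs (circulation P Q x y (w / 2 ^ n) (h / 2 ^ n))).
  destruct (bisection Bad w h x0 y0) as [xs [ys Hs]]; auto.
  - unfold Bad. simpl. rewrite !Rdiv_1_r. unfold eta. lra.
  - intros x y n [Hx0 [HxX HB]].
    set (u := w / 2 ^ S n). set (v := h / 2 ^ S n).
    assert (Eu : w / 2 ^ n = 2 * u) by (unfold u; simpl; field; apply pow_nonzero; lra).
    assert (Ev : h / 2 ^ n = 2 * v) by (unfold v; simpl; field; apply pow_nonzero; lra).
    assert (Ee : eta / 4 ^ n = 4 * (eta / 4 ^ S n)) by (simpl; field; apply pow_nonzero; lra).
    assert (Hu : 0 <= u) by (apply Rdiv_le_0_compat; auto; apply pow_lt; lra).
    rewrite Eu in *. rewrite Ev, Ee in HB.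
    assert (Add : circulation P Q x y (2 * u) (2 * v) =
       circulation P Q (x + 0) (y + 0) u v + circulation P Q (x + u) (y + 0) u v +
       (circulation P Q (x + 0) (y + v) u v + circulation P Q (x + u) (y + v) u v)).
    { unfold circulation. rewrite !Rplus_0_r.
      replace (x + u + u) with (x + 2 * u) by ring. replace (y + v + v) with (y + 2 * v) by ring.
      rewrite <- (RInt_Chasles (fun t => Q (x + 2 * u) t) y (y + v) (y + 2 * v)) by (apply EQ; lra).
      rewrite <- (RInt_Chasles (fun t => Q x t) y (y + v) (y + 2 * v)) by (apply EQ; lra).
      rewrite <- (RInt_Chasles (fun t => P t (y + 2 * v)) x (x + u) (x + 2 * u)) by (apply EP; lra).
      rewrite <- (RInt_Chasles (fun t => P t y) x (x + u) (x + 2 * u)) by (apply EP; lra).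
      unfold plus; simpl. ring. }
    apply NNPP. intros K.
    assert (Sm : forall i j, (i = 0 \/ i = u) -> (j = 0 \/ j = v) ->
       Rabs (circulation P Q (x + i) (y + j) u v) < eta / 4 ^ S n).
    { intros i j Hi Hj. apply Rnot_le_lt. intros K'. apply K. exists i, j. do 2 (split; auto).
      unfold Bad. fold u v. repeat split; auto; destruct Hi as [-> | ->]; lra. }
    assert (S1 := Sm 0 0 ltac:(auto) ltac:(auto)). assert (S2 := Sm u 0 ltac:(auto) ltac:(auto)).
    assert (S3 := Sm 0 v ltac:(auto) ltac:(auto)). assert (S4 := Sm u v ltac:(auto) ltac:(auto)).
    rewrite Add in HB.
    assert (T1 := Rabs_triang (circulation P Q (x + 0) (y + 0) u v + circulation P Q (x + u) (y + 0) u v)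
      (circulation P Q (x + 0) (y + v) u v + circulation P Q (x + u) (y + v) u v)).
    assert (T2 := Rabs_triang (circulation P Q (x + 0) (y + 0) u v) (circulation P Q (x + u) (y + 0) u v)).
    assert (T3 := Rabs_triang (circulation P Q (x + 0) (y + v) u v) (circulation P Q (x + u) (y + v) u v)).
    lra.
  - assert (HxsX : xs < X).
    { destruct (Hs O) as [x [y [_ [Hx [_ [H1 [H2 _]]]]]]]. lra. }
    destruct (HJ xs ys HxsX) as [a [b [c [JP JQ]]]].
    (* The added 1 only keeps [s] positive when the rectangle is degenerate. *)
    set (s := (w + h) ^ 2 + 1). assert (Hs1 : 0 < s) by (unfold s; nra).
    set (e := eta / (4 * s)). assert (He : 0 < e) by (apply Rdiv_lt_0_compat; lra).
    destruct (JP e He) as [d1 [Hd1 K1]]. destruct (JQ e He) as [d2 [Hd2 K2]].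
    set (d := Rmin (Rmin d1 d2) (X - (x0 + w))).
    assert (Hd : 0 < d) by (repeat apply Rmin_pos; lra).
    assert (L1 := Rmin_l d1 d2). assert (L2 := Rmin_r d1 d2).
    assert (L3 := Rmin_l (Rmin d1 d2) (X - (x0 + w))). assert (L4 := Rmin_r (Rmin d1 d2) (X - (x0 + w))).
    fold d in L3, L4.
    destruct (small_pow (w + h) d Hd) as [n Hn].
    destruct (Hs n) as [x [y [[Hx0 [HxX HB]] [Hx [Hy _]]]]].
    assert (P2 : 0 < 2 ^ n) by (apply pow_lt; lra).
    assert (Hwn : 0 <= w / 2 ^ n) by (apply Rdiv_le_0_compat; auto).
    assert (Hhn : 0 <= h / 2 ^ n) by (apply Rdiv_le_0_compat; auto).
    assert (Esum : (w + h) / 2 ^ n = w / 2 ^ n + h / 2 ^ n) by (field; lra).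
    assert (G : Rabs (circulation P Q x y (w / 2 ^ n) (h / 2 ^ n)) <=
              2 * e * (w / 2 ^ n + h / 2 ^ n) ^ 2).
    { apply circulation_small with (xs := xs) (ys := ys) (a := a) (b := b) (c := c) (d := d); auto; try lra.
      - intros t u v Hu Hv. apply EP; lra.
      - intros t u v Ht. apply EQ; lra.
      - intros x' y' H1 H2. apply K1; lra.
      - intros x' y' H1 H2. apply K2; lra. }
    rewrite <- Esum in G.
    assert (E4 : 4 ^ n = 2 ^ n * 2 ^ n) by (rewrite <- Rpow_mult_distr; f_equal; ring).
    assert (eta / 4 ^ n <= 2 * e * ((w + h) / 2 ^ n) ^ 2) by lra.
    replace (2 * e * ((w + h) / 2 ^ n) ^ 2) with (2 * e * (w + h) ^ 2 / 4 ^ n) in H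
      by (rewrite E4; field; lra).
    apply Rmult_le_compat_r with (r := 4 ^ n) in H; [|apply pow_le; lra].
    unfold Rdiv in H. rewrite !Rmult_assoc, Rinv_l, !Rmult_1_r in H by (apply pow_nonzero; lra).
    assert (E' : e * (4 * s) = eta) by (unfold e; field; lra).
    unfold s in E'. assert (0 < e * (w + h) ^ 2 \/ e * (w+h)^2 = 0) by nra. nra.
Qed.

(** * The complex exponential and the mean value inequality *)

Definition Cexp (z : C) : C := (exp (fst z) * cos (snd z), exp (fst z) * sin (snd z)).

Lemma Cexp_plus (a b : C) : Cexp (a + b) = (Cexp a * Cexp b)%C.
Proof.
  destruct a as [a1 a2], b as [b1 b2]. unfold Cexp, Cplus, Cmult; simpl.
  rewrite exp_plus, cos_plus, sin_plus. f_equal; ring.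
Qed.

Lemma Cexp_RtoC (x : R) : Cexp (RtoC x) = RtoC (exp x).
Proof. unfold Cexp, RtoC; simpl. rewrite cos_0, sin_0. f_equal; ring. Qed.

Lemma Cexp_0 : Cexp 0 = 1.
Proof. rewrite Cexp_RtoC, exp_0. reflexivity. Qed.

Lemma Cmod_Cexp (z : C) : Cmod (Cexp z) = exp (fst z).
Proof.
  destruct z as [x y]. unfold Cexp, Cmod; simpl.
  replace (exp x * cos y * (exp x * cos y * 1) + exp x * sin y * (exp x * sin y * 1))
    with ((exp x * exp x) * (Rsqr (sin y) + Rsqr (cos y))) by (unfold Rsqr; ring).
  rewrite sin2_cos2, Rmult_1_r. apply sqrt_square. left. apply exp_pos.
Qed.

Lemma Cexp_nz (z : C) : Cexp z <> 0.
Proof. apply Cmod_gt_0. rewrite Cmod_Cexp. apply exp_pos. Qed.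

Lemma Cexp_opp (z : C) : Cexp (- z) = (/ Cexp z)%C.
Proof.
  assert (H : (Cexp (- z) * Cexp z)%C = 1).
  { rewrite <- Cexp_plus. replace (- z + z)%C with (RtoC 0) by ring. apply Cexp_0. }
  replace (Cexp (- z)) with ((Cexp (- z) * Cexp z) * / Cexp z)%C.
  - rewrite H. ring.
  - field. apply Cexp_nz.
Qed.

Lemma Cexp_pow (z : C) n : (Cexp z ^ n)%C = Cexp (RtoC (INR n) * z).
Proof.
  induction n.
  - simpl. replace (RtoC 0 * z)%C with (RtoC 0) by ring. now rewrite Cexp_0.
  - rewrite Cpow_S, IHn, <- Cexp_plus. f_equal. rewrite S_INR, RtoC_plus. ring.
Qed.

Lemma deriv_lim_bound (f : R -> R) (x l : R) :
  derivable_pt_lim f x l ->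
  forall e, 0 < e -> exists d, 0 < d /\ forall h, Rabs h < d ->
    Rabs (f (x + h) - f x - l * h) <= e * Rabs h.
Proof.
  intros H e He. destruct (H e He) as [d Hd]. exists d. split; [apply cond_pos|].
  intros h Hh. destruct (Req_dec h 0) as [->|Hn].
  - rewrite Rplus_0_r. replace (f x - f x - l * 0) with 0 by ring. rewrite Rabs_R0. lra.
  - specialize (Hd h Hn Hh).
    replace (f (x + h) - f x - l * h) with (((f (x + h) - f x) / h - l) * h) by (field; auto).
    rewrite Rabs_mult. apply Rmult_le_compat_r; [apply Rabs_pos|lra].
Qed.

Lemma Cexp_diff_0 : Cderiv Cexp 0 1.
Proof.
  apply Cderiv_intro. intros e He. set (k := Rmin 1 (e / 10)).
  assert (Hk : 0 < k) by (apply Rmin_pos; lra).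
  assert (L1 := Rmin_l 1 (e/10)). assert (L2 := Rmin_r 1 (e/10)). fold k in L1, L2.
  destruct (deriv_lim_bound _ _ _ (derivable_pt_lim_exp 0) k Hk) as [d1 [Hd1 K1]].
  destruct (deriv_lim_bound _ _ _ derivable_pt_lim_sin_0 k Hk) as [d2 [Hd2 K2]].
  destruct (deriv_lim_bound _ _ _ derivable_pt_lim_cos_0 k Hk) as [d3 [Hd3 K3]].
  rewrite sin_0 in K2. rewrite cos_0 in K3. rewrite exp_0 in K1.
  set (d := Rmin (Rmin d1 d2) (Rmin d3 k)).
  assert (Hd : 0 < d) by (repeat apply Rmin_pos; lra).
  assert (M1 := Rmin_l d1 d2). assert (M2 := Rmin_r d1 d2).
  assert (M3 := Rmin_l d3 k). assert (M4 := Rmin_r d3 k).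
  assert (M5 := Rmin_l (Rmin d1 d2) (Rmin d3 k)). assert (M6 := Rmin_r (Rmin d1 d2) (Rmin d3 k)).
  fold d in M5, M6.
  exists d. split; auto. intros [x y] Hw.
  replace ((x, y) - RtoC 0)%C with (x, y) in * by (unfold Cminus, Cplus, Copp, RtoC; simpl; f_equal; ring).
  assert (Bx := re_le_Cmod (x, y)). simpl in Bx.
  assert (By : Rabs y <= Cmod (x, y)).
  { eapply Rle_trans; [|apply Rmax_Cmod]. apply Rmax_r. }
  set (W := Cmod (x, y)) in *.
  specialize (K1 x ltac:(lra)). specialize (K2 y ltac:(lra)). specialize (K3 y ltac:(lra)).
  rewrite Rplus_0_l in K1, K2, K3.
  replace (Cexp (x, y) - Cexp 0 - 1 * (x, y))%C with
    ((exp x - 1 - 1 * x) + exp x * (cos y - 1 - 0 * y), (exp x - 1 - 1 * x) * y + x * y + exp x * (sin y - 0 - 1 * y)).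
  2:{ rewrite Cexp_0. unfold Cexp, Cminus, Cplus, Copp, Cmult, RtoC; simpl. f_equal; ring. }
  eapply Rle_trans; [apply Cmod_le_abs|].
  assert (Ax := Rabs_pos x). assert (Ay := Rabs_pos y).
  assert (Xle : exp x <= 1 + 2 * Rabs x).
  { apply Rabs_le_between in K1. assert (x <= Rabs x) by apply RRle_abs.
    assert (k * Rabs x <= Rabs x) by nra. lra. }
  assert (E0 := exp_pos x).
  assert (E1 : exp x <= 1 + 2 * k) by lra.
  assert (T1 : Rabs (exp x - 1 - 1 * x + exp x * (cos y - 1 - 0 * y)) <= k * W + 3 * (k * W)).
  { eapply Rle_trans; [apply Rabs_triang|]. rewrite Rabs_mult, (Rabs_pos_eq (exp x)) by lra.
    apply Rplus_le_compat; [nra|]. apply Rmult_le_compat; try lra; [apply Rabs_pos|]. nra. }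
  assert (T2 : Rabs (exp x * (sin y - 0 - 1 * y)) <= (1 + 2 * k) * (k * W)).
  { rewrite Rabs_mult, (Rabs_pos_eq (exp x)) by lra.
    apply Rmult_le_compat; try lra; [apply Rabs_pos|]. nra. }
  assert (T3 : Rabs ((exp x - 1 - 1 * x) * y + x * y) <= (k * W) * k + k * W).
  { eapply Rle_trans; [apply Rabs_triang|]. rewrite !Rabs_mult.
    apply Rplus_le_compat; apply Rmult_le_compat; try lra; try apply Rabs_pos. nra. }
  assert (T4 := Rabs_triang ((exp x - 1 - 1 * x) * y + x * y) (exp x * (sin y - 0 - 1 * y))).
  assert (0 <= W) by apply Cmod_ge_0.
  assert (Rabs (exp x - 1 - 1 * x + exp x * (cos y - 1 - 0 * y)) +
    Rabs ((exp x - 1 - 1 * x) * y + x * y + exp x * (sin y - 0 - 1 * y)) <= 9 * (k * W)).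
  { assert (HkW : 0 <= k * W) by (apply Rmult_le_pos; lra).
    assert (k * W * k <= k * W * 1) by (apply Rmult_le_compat_l; lra).
    apply Rle_trans with (k * W + 3 * (k * W) + (k * W * k + k * W + (1 + 2 * k) * (k * W))); [|lra].
    apply Rplus_le_compat; [exact T1|]. eapply Rle_trans; [exact T4|]. lra. }
  assert (k * W <= e / 10 * W) by (apply Rmult_le_compat_r; lra).
  assert (0 <= e * W) by (apply Rmult_le_pos; lra). lra.
Qed.

Lemma Cexp_diff (z : C) : Cderiv Cexp z (Cexp z).
Proof.
  assert (H : Cderiv (fun w => Cexp z * Cexp (w + - z))%C z (0 * Cexp (z + - z) + Cexp z * (1 * (1 + 0)))).
  { apply (Cderiv_mult (fun _ => Cexp z) (fun w => Cexp (w + - z))%C); [apply Cderiv_const|].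
    apply (Cderiv_comp (fun w => w + - z)%C Cexp).
    - apply (Cderiv_plus (fun w => w) (fun _ => - z)%C); [apply Cderiv_id|apply Cderiv_const].
    - replace (z + - z)%C with (RtoC 0) by ring. apply Cexp_diff_0. }
  replace (0 * Cexp (z + - z) + Cexp z * (1 * (1 + 0)))%C with (Cexp z) in H by ring.
  eapply Cderiv_local; [apply Rlt_0_1| |exact H]. intros w _. simpl.
  rewrite <- Cexp_plus. f_equal. ring.
Qed.

Lemma Cderivable_exp (f : C -> C) (z : C) : Cderivable f z -> Cderivable (fun w => Cexp (f w)) z.
Proof. intros H. apply (Cderivable_comp f Cexp); auto. eexists. apply Cexp_diff. Qed.

(** The Cauchy-Riemann equations: they say that the form
    [Im g dx + Re g dy], the imaginary part of [g dz], is closed. *)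
Lemma jets_of_Cderiv (g : C -> C) (x y : R) (l : C) :
  Cderiv g (x, y) l ->
  jet (fun s t => snd (g (s, t))) x y (snd l) (fst l) /\
  jet (fun s t => fst (g (s, t))) x y (fst l) (- snd l).
Proof.
  intros [q [Hq [Hl [d [Hd H]]]]].
  assert (K : forall e, 0 < e -> exists d, 0 < d /\ forall x' y',
    Rabs (x' - x) < d -> Rabs (y' - y) < d ->
    Cmod (g (x', y') - g (x, y) - l * ((x' - x)%R, (y' - y)%R))%C <= e * (Rabs (x' - x) + Rabs (y' - y))).
  { intros e He. destruct (Hq e He) as [d' [Hd' H']].
    exists (Rmin (d / 2) (d' / 2)). split; [apply Rmin_pos; lra|]. intros x' y' H1 H2.
    assert (L1 := Rmin_l (d/2) (d'/2)). assert (L2 := Rmin_r (d/2) (d'/2)).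
    assert (Ex : ((x', y') - (x, y))%C = (x' - x, y' - y)) by reflexivity.
    assert (B := Cmod_le_abs (x' - x) (y' - y)).
    rewrite (H (x', y')) by (rewrite Ex; lra). rewrite Ex.
    replace (g (x, y) + q (x', y') * ((x' - x)%R, (y' - y)%R) - g (x, y) - l * ((x' - x)%R, (y' - y)%R))%C with
      ((q (x', y') - q (x, y)) * ((x' - x)%R, (y' - y)%R))%C by (rewrite Hl; ring).
    rewrite Cmod_mult. apply Rmult_le_compat; try apply Cmod_ge_0; auto.
    left. apply H'. rewrite Ex. lra. }
  assert (Im : forall w : C, Rabs (snd w) <= Cmod w).
  { intros w. eapply Rle_trans; [|apply Rmax_Cmod]. apply Rmax_r. }
  split; intros e He; destruct (K e He) as [d0 [Hd0 K0]]; exists d0; split; auto; intros x' y' H1 H2;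
    specialize (K0 x' y' H1 H2).
  - eapply Rle_trans; [|exact K0]. eapply Rle_trans; [|apply Im].
    right. f_equal. unfold Cminus, Cplus, Copp, Cmult; simpl. ring.
  - eapply Rle_trans; [|exact K0]. eapply Rle_trans; [|apply re_le_Cmod].
    right. f_equal. unfold Re, Cminus, Cplus, Copp, Cmult; simpl. ring.
Qed.

(** Mean value inequality for the real part.  In the coordinate
    [zeta = ln (z - z0)] the circles around [z0] are vertical segments of length
    [2 pi] and the function is [2 pi i]-periodic, so Goursat's theorem makes the
    circle mean independent of the radius; letting the radius tend to [0] gives
    the value at the centre.  Only continuity is used at [z0], which is what
    lets the maximum principle handle removable singularities. *)
Lemma circle_mean_le (F : C -> C) (z0 : C) (R0 rho m : R) :
  (forall z, 0 < Cmod (z - z0) < R0 -> Cderivable F z) -> Ccont F z0 -> 0 < rho < R0 ->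
  (forall z, Cmod (z - z0) = rho -> fst (F z) <= m) -> fst (F z0) <= m.
Proof.
  intros HF Hc [Hrho HR] Hm.
  set (g := fun zeta => F (z0 + Cexp zeta)%C).
  set (P := fun s t => snd (g (s, t))). set (Q := fun s t => fst (g (s, t))).
  assert (Mod : forall s t, Cmod (z0 + Cexp (s, t) - z0) = exp s).
  { intros s t. replace (z0 + Cexp (s, t) - z0)%C with (Cexp (s, t)) by ring. apply Cmod_Cexp. }
  assert (HJ : forall x y, x < ln R0 -> exists a b c, jet P x y a b /\ jet Q x y b c).
  { intros x y Hx.
    assert (Hg : Cderivable g (x, y)).
    { apply (Cderivable_comp (fun w => z0 + Cexp w)%C F).
      - apply (Cderivable_plus (fun _ => z0)); [apply Cderivable_const|]. apply (Cderivable_exp (fun w => w)), Cderivable_id.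
      - apply HF. rewrite Mod. split; [apply exp_pos|].
        apply ln_lt_inv; [apply exp_pos|lra|]. now rewrite ln_exp. }
    destruct Hg as [l Hl]. destruct (jets_of_Cderiv g x y l Hl) as [J1 J2].
    exists (snd l), (fst l), (- snd l). auto. }
  assert (EQ : forall x, x < ln R0 -> ex_RInt (fun s => Q x s) 0 (2 * PI)).
  { intros x Hx. apply (ex_RInt_continuous (V := R_CompleteNormedModule)). intros z Hz.
    destruct (HJ x z) as [a [b [c [_ H1]]]]; auto. eapply jet_cts_v; eauto. }
  assert (Pi := PI_RGT_0).
  assert (C1 : forall c, RInt (fun _ => c) 0 (2 * PI) = c * (2 * PI)).
  { intros c. rewrite RInt_const. unfold scal; simpl. unfold mult; simpl. ring. }
  assert (Per : forall s, P s (0 + 2 * PI) = P s 0).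
  { intros s. unfold P, g. replace (Cexp (s, 0 + 2 * PI)) with (Cexp (s, 0)); auto.
    unfold Cexp, fst, snd. rewrite cos_plus, sin_plus, cos_2PI, sin_2PI. f_equal; ring. }
  assert (Hln : ln rho < ln R0) by (apply ln_increasing; lra).
  assert (Const : forall x, x < ln rho ->
     RInt (fun t => Q (ln rho) t) 0 (2 * PI) = RInt (fun t => Q x t) 0 (2 * PI)).
  { intros x Hx.
    assert (G := goursat P Q (ln R0) HJ x 0 (ln rho - x) (2 * PI) ltac:(lra) ltac:(lra) ltac:(lra)).
    unfold circulation in G.
    rewrite (RInt_ext (fun t => P t (0 + 2 * PI)) (fun t => P t 0)) in G by (intros; apply Per).
    replace (x + (ln rho - x)) with (ln rho) in G by ring.
    rewrite Rplus_0_l in G. lra. }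
  assert (Up : RInt (fun t => Q (ln rho) t) 0 (2 * PI) <= m * (2 * PI)).
  { rewrite <- C1. apply RInt_le; try lra; auto. apply ex_RInt_const.
    intros t _. apply Hm. rewrite Mod. apply exp_ln. lra. }
  apply le_epsilon. intros e He.
  destruct (Hc e He) as [d [Hd Kd]].
  (* A circle so small that [F] differs from [F z0] by less than [e] on it. *)
  set (x := ln (Rmin (d / 2) (rho / 2))).
  assert (Hmin : 0 < Rmin (d / 2) (rho / 2)) by (apply Rmin_pos; lra).
  assert (L1 := Rmin_l (d/2) (rho/2)). assert (L2 := Rmin_r (d/2) (rho/2)).
  assert (Hx : x < ln rho) by (apply ln_increasing; lra).
  assert (Lo : (fst (F z0) - e) * (2 * PI) <= RInt (fun t => Q x t) 0 (2 * PI)).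
  { rewrite <- C1. apply RInt_le; try lra; [apply ex_RInt_const|apply EQ; lra|].
    intros t _. unfold Q, g.
    assert (Hlt : Cmod (F (z0 + Cexp (x, t)) - F z0)%C < e).
    { apply Kd. rewrite Mod. unfold x. rewrite exp_ln; lra. }
    assert (B := re_le_Cmod (F (z0 + Cexp (x, t)) - F z0)%C).
    unfold Re in B. simpl in B. apply Rabs_le_between in B. lra. }
  rewrite <- (Const x Hx) in Lo.
  apply Rmult_le_reg_r with (2 * PI); [lra|]. nra.
Qed.

(** * Maximum principle, Schwarz lemma, Harnack inequality *)

Lemma Cmod_sq (z : C) : Cmod z ^ 2 = fst z ^ 2 + snd z ^ 2.
Proof. apply Cmod2_alt. Qed.

Lemma rotate_to_Cmod (w : C) : exists u : C, Cmod u = 1 /\ (u * w)%C = RtoC (Cmod w).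
Proof.
  destruct (excluded_middle_informative (w = 0)) as [->|H].
  - exists 1. rewrite Cmod_1, Cmod_0. split; auto. ring.
  - assert (P := proj1 (Cmod_gt_0 w) H). exists (RtoC (Cmod w) / w)%C. split.
    + rewrite Cmod_div by auto. rewrite Cmod_R, Rabs_pos_eq by lra. field. lra.
    + field. auto.
Qed.

Lemma fst_le_Cmod (w : C) : fst w <= Cmod w.
Proof. eapply Rle_trans; [apply RRle_abs|apply re_le_Cmod]. Qed.

(** Strict subharmonicity of [|F| + e |z|^2].  As
    [|z|^2 = |z0|^2 + 2 Re (conj z0 (z - z0)) + |z - z0|^2], on the circle the
    perturbation is its value at [z0] plus [e rho^2] plus the real part of a holomorphic function that
    vanishes at [z0], and the mean value inequality can be applied to one
    holomorphic function. *)
Lemma perturbed_modulus_no_max (F : C -> C) (z0 : C) (R0 rho e : R) :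
  (forall z, 0 < Cmod (z - z0) < R0 -> Cderivable F z) -> Ccont F z0 -> 0 < rho < R0 -> 0 < e ->
  ~ (forall z, Cmod (z - z0) = rho -> Cmod (F z) + e * Cmod z ^ 2 <= Cmod (F z0) + e * Cmod z0 ^ 2).
Proof.
  intros HF Hc Hrho He Hmax.
  destruct (rotate_to_Cmod (F z0)) as [u [Hu Hu0]].
  (* [u] rotates [F z0] to the positive axis, so that its real part is its modulus. *)
  set (H := fun z => (u * F z + RtoC (2 * e) * Cconj z0 * (z + - z0))%C).
  assert (L : fst (H z0) <= Cmod (F z0) - e * rho ^ 2).
  { apply circle_mean_le with (R0 := R0) (rho := rho); auto.
    - intros z Hz. apply Cderivable_plus; apply Cderivable_mult; try apply Cderivable_const; auto.
      apply Cderivable_plus; [apply Cderivable_id|apply Cderivable_const].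
    - apply Ccont_plus; apply Ccont_mult; try apply Ccont_const; auto.
      apply Ccont_plus; [apply Ccont_id|apply Ccont_const].
    - intros z Hz. specialize (Hmax z Hz).
      assert (S1 := Cmod_sq z). assert (S2 := Cmod_sq z0). assert (S3 := Cmod_sq (z - z0)%C).
      rewrite Hz in S3.
      assert (B : fst (u * F z)%C <= Cmod (F z)).
      { eapply Rle_trans; [apply fst_le_Cmod|]. rewrite Cmod_mult, Hu. lra. }
      unfold H. change (fst (u * F z)%C + fst (RtoC (2 * e) * Cconj z0 * (z + - z0))%C <= Cmod (F z0) - e * rho ^ 2).
      assert (E : fst (RtoC (2 * e) * Cconj z0 * (z + - z0))%C = e * (Cmod z ^ 2 - Cmod z0 ^ 2 - rho ^ 2)).
      { rewrite S1, S2, S3. destruct z as [a b], z0 as [a0 b0].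
        unfold Cminus, Cplus, Copp, Cmult, Cconj, RtoC; simpl. ring. }
      rewrite E. lra. }
  assert (E : fst (H z0) = Cmod (F z0)).
  { unfold H. rewrite Hu0. replace (z0 + - z0)%C with (RtoC 0) by ring.
    rewrite Cmult_0_r, Cplus_0_r. reflexivity. }
  rewrite E in L. assert (0 < e * rho ^ 2). { apply Rmult_lt_0_compat; auto. apply pow_lt; lra. } lra.
Qed.

(** The modulus perturbed by [e |z|^2] attains its maximum over the disc, and
    cannot do so inside.  The exceptional point [0], where [F] is only
    continuous, may be the centre of the test circle but must not lie elsewhere
    inside it. *)
Lemma max_principle (F : C -> C) (R0 r m : R) :
  (forall z, 0 < Cmod z < R0 -> Cderivable F z) -> Ccont F 0 -> 0 < r < R0 ->
  (forall z, Cmod z = r -> Cmod (F z) <= m) ->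
  forall z, Cmod z <= r -> Cmod (F z) <= m.
Proof.
  intros HF Hc Hr Hm z1 Hz1. apply Rnot_lt_le. intros Hlt.
  assert (Hcts : forall z, Cmod z < R0 -> Ccont F z).
  { intros z Hz. destruct (excluded_middle_informative (z = 0)) as [->|N]; auto.
    apply Cderivable_cts, HF. split; auto. now apply Cmod_gt_0. }
  set (e := (Cmod (F z1) - m) / (2 * r ^ 2)).
  assert (Hr2 : 0 < r ^ 2) by (apply pow_lt; lra).
  assert (He : 0 < e) by (apply Rdiv_lt_0_compat; lra).
  assert (Her : e * r ^ 2 = (Cmod (F z1) - m) / 2) by (unfold e; field; lra).
  destruct (disc_max (fun z => Cmod (F z) + e * Cmod z ^ 2) r) as [z2 [Hz2 Hmax]]; [lra| |].
  { intros z Hz k Hk.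
    assert (C1 : Ccont (fun w => F w) z) by (apply Hcts; lra).
    destruct (C1 (k / 2)) as [d [Hd K]]; [lra|].
    set (k2 := k / 2 / (e * (2 * r + 1))).
    assert (He2 : 0 < e * (2 * r + 1)) by (apply Rmult_lt_0_compat; lra).
    assert (Hk2 : 0 < k2) by (apply Rdiv_lt_0_compat; lra).
    exists (Rmin d k2). split; [now apply Rmin_pos|]. intros w Hw Hd2.
    assert (L1 := Rmin_l d k2). assert (L2 := Rmin_r d k2).
    assert (B1 := Cmod_rev_triangle (F w) (F z)). assert (B2 := Cmod_rev_triangle (F z) (F w)).
    rewrite (Cmod_sub_sym (F z)) in B2. specialize (K w ltac:(lra)).
    assert (B3 := Cmod_rev_triangle w z). assert (B4 := Cmod_rev_triangle z w).
    rewrite (Cmod_sub_sym z) in B4.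
    assert (Q1 := Cmod_ge_0 w). assert (Q2 := Cmod_ge_0 z).
    assert (D : Rabs (e * Cmod w ^ 2 - e * Cmod z ^ 2) <= e * (2 * r + 1) * Cmod (w - z)).
    { replace (e * Cmod w ^ 2 - e * Cmod z ^ 2) with (e * ((Cmod w + Cmod z) * (Cmod w - Cmod z))) by ring.
      rewrite Rabs_mult, Rabs_pos_eq by lra. rewrite Rmult_assoc. apply Rmult_le_compat_l; [lra|].
      rewrite Rabs_mult. apply Rmult_le_compat; try apply Rabs_pos.
      - rewrite Rabs_pos_eq; lra.
      - apply Rabs_le; lra. }
    assert (D2 : e * (2 * r + 1) * Cmod (w - z) < k / 2).
    { apply Rlt_le_trans with (e * (2 * r + 1) * k2); [apply Rmult_lt_compat_l; lra|].
      right. unfold k2. field. lra. }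
    apply Rabs_le_between in D. apply Rabs_def1; lra. }
  assert (M1 := Hmax z1 Hz1). simpl in M1.
  assert (P1 : 0 <= e * (Cmod z1 * (Cmod z1 * 1))).
  { apply Rmult_le_pos; [lra|]. assert (Q := Cmod_ge_0 z1). nra. }
  assert (Hz2r : Cmod z2 < r).
  { destruct Hz2 as [|Eq]; auto. exfalso. specialize (Hm z2 Eq). rewrite Eq in M1. simpl in Her. lra. }
  assert (Hin : forall rho, 0 < rho -> Cmod z2 + rho <= r ->
     (forall z, 0 < Cmod (z - z2) < 2 * rho -> Cderivable F z) -> False).
  { intros rho Hrho Hle HF2.
    apply (perturbed_modulus_no_max F z2 (2 * rho) rho e); auto; try lra.
    - apply Hcts; lra.
    - intros z Hz. apply Hmax. assert (B := Cmod_rev_triangle z z2). lra. }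
  destruct (excluded_middle_informative (z2 = 0)) as [->|N].
  - rewrite Cmod_0 in *. apply (Hin (r / 2)); try lra. intros z Hz. apply HF.
    replace (z - 0)%C with z in Hz by ring. lra.
  - assert (Pz := proj1 (Cmod_gt_0 z2) N).
    assert (Q1 := Rmin_l (r - Cmod z2) (Cmod z2)). assert (Q2 := Rmin_r (r - Cmod z2) (Cmod z2)).
    assert (Q3 : 0 < Rmin (r - Cmod z2) (Cmod z2)) by (apply Rmin_pos; lra).
    apply (Hin (Rmin (r - Cmod z2) (Cmod z2) / 2)); try lra.
    intros z Hz. apply HF.
    assert (B1 := Cmod_rev_triangle z z2). assert (B2 := Cmod_rev_triangle z2 z).
    rewrite (Cmod_sub_sym z2) in B2. lra.
Qed.

Lemma Cderiv_quotient (f : C -> C) (l : C) :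
  Cderiv f 0 l -> f 0 = 0 ->
  exists q : C -> C, q 0 = l /\ Ccont q 0 /\ (forall z : C, z <> 0 -> q z = (f z / z)%C).
Proof.
  intros [q [Hq [Hl [d [Hd H]]]]] H0.
  exists (fun z : C => if excluded_middle_informative (z = 0) then l else (f z / z)%C).
  destruct (excluded_middle_informative (RtoC 0 = 0)) as [_|K]; [|now destruct K].
  split; auto. split.
  - apply Ccont_local with (g := q) (d := d); auto. intros w Hw.
    destruct (excluded_middle_informative (w = 0)) as [->|N]; [now rewrite Hl|].
    rewrite (H w Hw), H0. field. auto.
  - intros z Hz. destruct (excluded_middle_informative (z = 0)); tauto.
Qed.

(** The maximum principle for [f z / z], continued by [l] at the origin. *)
Lemma schwarz (f : C -> C) (R0 r m : R) (l : C) :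
  (forall z, Cmod z < R0 -> Cderivable f z) -> Cderiv f 0 l -> f 0 = 0 -> 0 < r < R0 ->
  (forall z, Cmod z = r -> Cmod (f z) <= m) ->
  Cmod l <= m / r /\ forall z, Cmod z <= r -> Cmod (f z) <= m / r * Cmod z.
Proof.
  intros Hf Hl H0 Hr Hm.
  destruct (Cderiv_quotient f l Hl H0) as [q [Hq0 [Hqc Hq]]].
  assert (M : forall z, Cmod z <= r -> Cmod (q z) <= m / r).
  { apply max_principle with (R0 := R0); auto.
    - intros z [Hz1 Hz2]. assert (Hz : z <> 0) by now apply Cmod_gt_0.
      apply Cderivable_local with (g := fun w => (f w / w)%C) (d := Cmod z); auto.
      + intros w Hw. apply Hq. intros ->. rewrite Cmod_sub_sym in Hw.
        replace (z - 0)%C with z in Hw by ring. lra.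
      + apply Cderivable_div; auto. apply Cderivable_id.
    - intros z Hz. assert (N : z <> 0) by (apply Cmod_gt_0; lra).
      rewrite Hq, Cmod_div, Hz by auto. apply Rmult_le_compat_r; auto.
      left. apply Rinv_0_lt_compat. lra. }
  split.
  - rewrite <- Hq0. apply M. rewrite Cmod_0. lra.
  - intros z Hz. destruct (excluded_middle_informative (z = 0)) as [->|N].
    + rewrite H0, Cmod_0. lra.
    + specialize (M z Hz). rewrite Hq, Cmod_div in M by auto.
      assert (P := proj1 (Cmod_gt_0 z) N).
      apply Rmult_le_compat_r with (r := Cmod z) in M; [|lra].
      unfold Rdiv in M at 1. rewrite Rmult_assoc, Rinv_l, Rmult_1_r in M; lra.
Qed.

(** The Schwarz lemma for the Cayley transform [(g - A) / (g + A)], which maps the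
    right half plane to the disc and [A] to [0]. *)
Lemma harnack (g : C -> C) (R0 r k A : R) :
  (forall z, Cmod z < R0 -> Cderivable g z) -> (forall z, Cmod z < R0 -> 0 <= fst (g z)) ->
  g 0 = RtoC A -> 0 < A -> 0 < r < R0 -> k < 1 ->
  forall z, Cmod z <= k * r -> fst (g z) * (1 - k) <= A * (1 + k).
Proof.
  intros Hg Hpos H0 HA Hr Hk z Hz.
  assert (Nz : forall w, Cmod w < R0 -> (g w + RtoC A)%C <> 0).
  { intros w Hw E. specialize (Hpos w Hw). apply (f_equal fst) in E. simpl in E. lra. }
  set (phi := fun w => ((g w + - RtoC A) / (g w + RtoC A))%C).
  assert (Hphi : forall w, Cmod w < R0 -> Cderivable phi w).
  { intros w Hw. apply Cderivable_div; auto; apply Cderivable_plus; auto; apply Cderivable_const. }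
  assert (Hle : forall w, Cmod w < R0 -> Cmod (g w + - RtoC A)%C <= Cmod (g w + RtoC A)%C).
  { intros w Hw. specialize (Hpos w Hw). apply Rsqr_incr_0; try apply Cmod_ge_0.
    rewrite !Rsqr_pow2, !Cmod_sq. destruct (g w) as [a b]; simpl in *. nra. }
  destruct (Hphi 0) as [l Hl]; [rewrite Cmod_0; lra|].
  destruct (schwarz phi R0 r 1 l) as [_ Sz]; auto.
  { unfold phi. rewrite H0. replace (RtoC A + - RtoC A)%C with (RtoC 0) by ring.
    unfold Cdiv. ring. }
  { intros w Hw. assert (Hw' : Cmod w < R0) by lra. unfold phi. rewrite Cmod_div by auto.
    assert (P := proj1 (Cmod_gt_0 _) (Nz w Hw')).
    apply Rmult_le_reg_r with (Cmod (g w + RtoC A)); auto.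
    unfold Rdiv. rewrite Rmult_assoc, Rinv_l, Rmult_1_r; [|lra]. rewrite Rmult_1_l. auto. }
  assert (Hzr : Cmod z <= r) by nra. assert (HzR : Cmod z < R0) by lra.
  specialize (Sz z Hzr).
  assert (Hk' : Cmod (phi z) <= k).
  { eapply Rle_trans; [exact Sz|]. apply Rmult_le_reg_r with r; [lra|].
    replace (1 / r * Cmod z * r) with (Cmod z) by (field; lra). lra. }
  unfold phi in Hk'. rewrite Cmod_div in Hk' by auto.
  assert (P := proj1 (Cmod_gt_0 _) (Nz z HzR)).
  apply Rmult_le_compat_r with (r := Cmod (g z + RtoC A)) in Hk'; [|lra].
  unfold Rdiv in Hk'. rewrite Rmult_assoc, Rinv_l, Rmult_1_r in Hk' by lra.
  assert (K0 : 0 <= k). { assert (Q := Cmod_ge_0 (g z + - RtoC A)). nra. }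
  assert (T1 := Cmod_triangle (g z) (RtoC A)). rewrite Cmod_R, Rabs_pos_eq in T1 by lra.
  assert (T2 := Cmod_rev_triangle (g z) (RtoC A)). rewrite Cmod_R, Rabs_pos_eq in T2 by lra.
  unfold Cminus in T2. assert (F := fst_le_Cmod (g z)). specialize (Hpos z HzR).
  apply Rle_trans with (Cmod (g z) * (1 - k)); [apply Rmult_le_compat_r; lra|]. nra.
Qed.

(** * Holomorphic logarithms and distance to an omitted value *)

(** The principal branch, meaningful on the right half plane only. *)
Definition Clog (w : C) : C := (RtoC (ln (Cmod w)) + Ci * RtoC (atan (snd w / fst w)))%C.

Lemma Cexp_Clog (w : C) : 0 < fst w -> Cexp (Clog w) = w.
Proof.
  intros H. destruct w as [x y]. simpl in H.
  assert (N : (x, y) <> RtoC 0). { intros E. apply (f_equal fst) in E. simpl in E. lra. }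
  assert (P := proj1 (Cmod_gt_0 _) N).
  assert (E : Clog (x, y) = (ln (Cmod (x, y)), atan (y / x))).
  { unfold Clog, Cplus, Cmult, Ci, RtoC; simpl. f_equal; ring. }
  rewrite E. unfold Cexp. simpl fst; simpl snd. rewrite exp_ln by auto.
  rewrite cos_atan, sin_atan.
  assert (S : 0 < sqrt (1 + Rsqr (y / x))).
  { apply sqrt_lt_R0. assert (Q := Rle_0_sqr (y / x)). lra. }
  assert (M : Cmod (x, y) = x * sqrt (1 + Rsqr (y / x))).
  { unfold Cmod; simpl. transitivity (sqrt (Rsqr x) * sqrt (1 + Rsqr (y / x))); [|now rewrite sqrt_Rsqr by lra].
    rewrite <- sqrt_mult.
    - f_equal. unfold Rsqr. field. lra.
    - apply Rle_0_sqr.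
    - assert (Q := Rle_0_sqr (y / x)). lra. }
  rewrite M. f_equal; field; lra.
Qed.

Lemma Ccont_real (phi : C -> R) (g : R -> R) (z : C) :
  Ccont (fun w => RtoC (phi w)) z -> continuity_pt g (phi z) ->
  Ccont (fun w => RtoC (g (phi w))) z.
Proof.
  intros Hp Hg e He. destruct (Hg e He) as [d [Hd K]]. destruct (Hp d Hd) as [d' [Hd' K']].
  exists d'. split; auto. intros w Hw. specialize (K' w Hw).
  rewrite <- RtoC_minus, Cmod_R in *.
  destruct (Req_dec (phi z) (phi w)) as [E|N].
  - rewrite E, Rminus_diag, Rabs_R0. auto.
  - apply K. simpl. unfold D_x, no_cond, R_dist. auto.
Qed.

Lemma Ccont_conj (z : C) : Ccont Cconj z.
Proof.
  intros e He. exists e. split; auto. intros w Hw.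
  replace (Cconj w - Cconj z)%C with (Cconj (w - z)).
  - now rewrite Cmod_conj.
  - unfold Cconj, Cminus, Cplus, Copp; simpl. f_equal; ring.
Qed.

Lemma Ccont_ext (f g : C -> C) z : (forall w, f w = g w) -> Ccont g z -> Ccont f z.
Proof. intros H. apply Ccont_local with (d := 1); auto. lra. Qed.

Lemma Ccont_Clog (z : C) : 0 < fst z -> Ccont Clog z.
Proof.
  intros Hz. apply Ccont_plus; [|apply Ccont_mult; [apply Ccont_const|]].
  - apply Ccont_real.
    + intros e He. exists e. split; auto. intros w Hw. rewrite <- RtoC_minus, Cmod_R.
      assert (B1 := Cmod_rev_triangle w z). assert (B2 := Cmod_rev_triangle z w).
      rewrite (Cmod_sub_sym z) in B2. apply Rabs_def1; lra.
    + apply derivable_continuous_pt. exists (/ Cmod z). apply derivable_pt_lim_ln.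
      assert (B := fst_le_Cmod z). lra.
  - apply (Ccont_real (fun w => snd w / fst w) atan).
    + assert (F1 : Ccont (fun w => RtoC (fst w)) z).
      { apply Ccont_ext with (g := fun w => (RtoC (1/2) * (w + Cconj w))%C).
        - intros [a b]. unfold Cconj, Cplus, Cmult, RtoC; simpl. f_equal; field.
        - apply Ccont_mult; [apply Ccont_const|]. apply Ccont_plus; [apply Ccont_id|apply Ccont_conj]. }
      assert (F2 : Ccont (fun w => RtoC (snd w)) z).
      { apply Ccont_ext with (g := fun w => (- Ci * (w + - RtoC 1 * RtoC (fst w)))%C).
        - intros [a b]. unfold Cplus, Cmult, Copp, Ci, RtoC; simpl. f_equal; ring.
        - apply Ccont_mult; [apply Ccont_const|]. apply Ccont_plus; [apply Ccont_id|].
          apply Ccont_mult; [apply Ccont_const|exact F1]. }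
      apply Ccont_local with (g := fun w => (RtoC (snd w) * / RtoC (fst w))%C) (d := fst z); auto.
      * intros w Hw. assert (B := re_le_Cmod (w - z)%C). unfold Re in B. simpl in B.
        assert (B' : Rabs (fst w + - fst z) < fst z) by lra. apply Rabs_lt_between in B'.
        unfold Rdiv. rewrite RtoC_mult, RtoC_inv by lra. reflexivity.
      * apply Ccont_mult; auto. apply (Ccont_comp (fun w => RtoC (fst w)) Cinv); auto.
        apply Ccont_inv. intros E. apply RtoC_inj in E. lra.
    + apply derivable_continuous_pt, derivable_pt_atan.
Qed.

(** Inverting the difference quotient of [Cexp] at [Clog z]: it is continuous there
    with value [z], hence nonzero nearby. *)
Lemma Cderivable_Clog (z : C) : 0 < fst z -> Cderivable Clog z.
Proof.
  intros Hz. assert (Cl := Ccont_Clog z Hz).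
  destruct (Cexp_diff (Clog z)) as [q [Hq [Hl [d [Hd H]]]]].
  rewrite Cexp_Clog in Hl by auto.
  assert (Nz : z <> RtoC 0). { intros ->. simpl in Hz. lra. }
  assert (P := proj1 (Cmod_gt_0 _) Nz).
  assert (Cq : Ccont (fun w => q (Clog w)) z) by (apply (Ccont_comp Clog q); auto).
  destruct (Cl d Hd) as [d1 [Hd1 K1]]. destruct (Cq (Cmod z) P) as [d2 [Hd2 K2]].
  exists (/ q (Clog z))%C, (fun w => / q (Clog w))%C. split; [|split; auto].
  - apply (Ccont_comp (fun w => q (Clog w)) Cinv); auto. apply Ccont_inv. now rewrite Hl.
  - exists (Rmin (fst z) (Rmin d1 d2)). split; [repeat apply Rmin_pos; auto|].
    intros w Hw. assert (L1 := Rmin_l d1 d2). assert (L2 := Rmin_r d1 d2).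
    assert (L3 := Rmin_l (fst z) (Rmin d1 d2)). assert (L4 := Rmin_r (fst z) (Rmin d1 d2)).
    assert (B := re_le_Cmod (w - z)%C). unfold Re in B. simpl in B.
    assert (B' : Rabs (fst w + - fst z) < fst z) by lra. apply Rabs_lt_between in B'.
    specialize (H (Clog w) ltac:(apply K1; lra)). rewrite !Cexp_Clog in H by lra.
    specialize (K2 w ltac:(lra)). rewrite Hl in K2.
    assert (Nq : q (Clog w) <> 0).
    { intros E. rewrite E, Cmod_sub_sym in K2. replace (z - 0)%C with z in K2 by ring. lra. }
    rewrite H at 3. field. auto.
Qed.

Lemma Clog_exists (w : C) : w <> 0 -> exists l, Cexp l = w.
Proof.
  intros Hw.
  (* It suffices to rotate [w] into the right half plane. *)
  assert (K : forall t : R, 0 < fst (Cexp (0, t) * w)%C -> exists l, Cexp l = w).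
  { intros t Ht. exists (Clog (Cexp (0, t) * w) + - (0, t))%C.
    rewrite Cexp_plus, Cexp_opp, Cexp_Clog by auto. field. apply Cexp_nz. }
  destruct w as [x y].
  destruct (Rlt_le_dec 0 x) as [H|H].
  { apply (K 0). unfold Cexp; simpl. rewrite exp_0, cos_0, sin_0. lra. }
  destruct (Rlt_le_dec x 0) as [H'|H'].
  { apply (K PI). unfold Cexp; simpl. rewrite exp_0, cos_PI, sin_PI. lra. }
  assert (x = 0) by lra. subst x.
  destruct (Rlt_le_dec 0 y) as [I|I].
  { apply (K (- (PI / 2))). unfold Cexp; simpl. rewrite exp_0, cos_neg, sin_neg, cos_PI2, sin_PI2. lra. }
  destruct (Rlt_le_dec y 0) as [I'|I'].
  { apply (K (PI / 2)). unfold Cexp; simpl. rewrite exp_0, cos_PI2, sin_PI2. lra. }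
  exfalso. apply Hw. replace y with 0 by lra. reflexivity.
Qed.

(** Without primitives: write [h z] as [h 0] times the product over [j < n] of the
    ratios [h (z (j+1) / n) / h (z j / n)].  By compactness all of them lie in the
    right half plane when [n] is large, so that their principal logarithms can be
    added. *)
Lemma log_on_disc (h : C -> C) (R0 r : R) (a : C) :
  (forall z, Cmod z < R0 -> Cderivable h z) -> (forall z, Cmod z < R0 -> h z <> 0) ->
  0 < r < R0 -> Cexp a = h 0 ->
  exists l : C -> C, l 0 = a /\ forall z, Cmod z <= r -> Cderivable l z /\ Cexp (l z) = h z.
Proof.
  intros Hh Hn Hr Ha.
  destruct (disc_compact (fun z b => forall z', Cmod z' <= r -> Cmod (z' - z) * b < 1 ->
      0 < fst (h z' / h z)%C) r) as [b Hb].
  { intros z b b' Hbb H z' Hz' Hlt. apply H; auto. eapply Rle_lt_trans; [|exact Hlt].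
    apply Rmult_le_compat_l; [apply Cmod_ge_0|auto]. }
  (* If [h] varies by less than a quarter of [|h z|] near [z], ratios of nearby
     values differ from 1 by less than 2/3. *)
  { intros z Hz. assert (HzR : Cmod z < R0) by lra.
    assert (P := proj1 (Cmod_gt_0 _) (Hn z HzR)).
    destruct (Cderivable_cts _ _ (Hh z HzR) (Cmod (h z) / 4)) as [d [Hd K]]; [lra|].
    exists (d / 2), (2 / d). split; [lra|]. intros z1 Hz1 D1 z2 Hz2 D2.
    assert (D2' : Cmod (z2 - z1) < d / 2).
    { apply Rmult_lt_reg_r with (2 / d); [apply Rdiv_lt_0_compat; lra|].
      replace (d / 2 * (2 / d)) with 1 by (field; lra). auto. }
    assert (T := Cmod_sub_triangle z2 z1 z).
    assert (K1 := K z1 ltac:(lra)). assert (K2 := K z2 ltac:(lra)).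
    assert (T2 := Cmod_sub_triangle (h z2) (h z) (h z1)). rewrite (Cmod_sub_sym (h z) (h z1)) in T2.
    assert (T3 := Cmod_rev_triangle (h z) (h z1)). rewrite (Cmod_sub_sym (h z) (h z1)) in T3.
    assert (N1 := Hn z1 ltac:(lra)).
    assert (E : (h z2 / h z1)%C = (1 + (h z2 - h z1) / h z1)%C) by (field; auto).
    assert (S : Cmod ((h z2 - h z1) / h z1) < 1).
    { rewrite Cmod_div by auto. apply Rmult_lt_reg_r with (Cmod (h z1)); [lra|].
      unfold Rdiv. rewrite Rmult_assoc, Rinv_l, Rmult_1_r by lra. lra. }
    rewrite E. assert (B := re_le_Cmod ((h z2 - h z1) / h z1)%C). unfold Re in B.
    assert (B' : Rabs (fst ((h z2 - h z1) / h z1)%C) < 1) by lra. apply Rabs_lt_between in B'.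
    change (0 < 1 + fst ((h z2 - h z1) / h z1)%C). lra. }
  destruct (INR_unbounded (r * Rabs b + 1)) as [n Hn'].
  assert (Hrb : 0 <= r * Rabs b) by (apply Rmult_le_pos; [lra|apply Rabs_pos]).
  assert (Hnpos : 0 < INR n) by lra.
  assert (Ind : forall j, (j <= n)%nat -> exists l : C -> C, forall z, Cmod z <= r ->
     Cderivable l z /\ Cexp (l z) = h (z * RtoC (INR j / INR n))%C).
  { induction j; intros Hj.
    - exists (fun _ => a). intros z Hz. split; [apply Cderivable_const|].
      rewrite Ha. f_equal. simpl. unfold Rdiv. rewrite Rmult_0_l. ring.
    - destruct IHj as [l Hl]; [lia|].
      assert (Bd : forall i z, (i <= n)%nat -> Cmod z <= r -> Cmod (z * RtoC (INR i / INR n)) <= r).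
      { intros i z Hi Hz. rewrite Cmod_mult, Cmod_R.
        assert (Hi1 : 0 <= INR i / INR n) by (apply Rdiv_le_0_compat; auto; apply pos_INR).
        assert (Hi2 : INR i / INR n <= 1).
        { apply Rmult_le_reg_r with (INR n); auto. unfold Rdiv.
          rewrite Rmult_assoc, Rinv_l, Rmult_1_r, Rmult_1_l by lra. now apply le_INR. }
        rewrite Rabs_pos_eq by auto. assert (Q := Cmod_ge_0 z). nra. }
      exists (fun z => l z + Clog (h (z * RtoC (INR (S j) / INR n)) / h (z * RtoC (INR j / INR n))))%C.
      intros z Hz. destruct (Hl z Hz) as [L1 L2].
      assert (B1 := Bd (S j) z Hj Hz). assert (B2 := Bd j z ltac:(lia) Hz).
      assert (Pos : 0 < fst (h (z * RtoC (INR (S j) / INR n)) / h (z * RtoC (INR j / INR n)))%C).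
      { apply (Hb _ B2 _ B1).
        replace (z * RtoC (INR (S j) / INR n) - z * RtoC (INR j / INR n))%C with (z * RtoC (/ INR n))%C.
        2:{ rewrite S_INR. replace ((INR j + 1) / INR n) with (INR j / INR n + / INR n) by (field; lra).
            rewrite RtoC_plus. ring. }
        rewrite Cmod_mult, Cmod_R, Rabs_pos_eq by (left; now apply Rinv_0_lt_compat).
        apply Rmult_lt_reg_r with (INR n); auto.
        replace (Cmod z * / INR n * b * INR n) with (Cmod z * b) by (field; lra).
        assert (Q := Cmod_ge_0 z). assert (Q2 := RRle_abs b). assert (Q3 := Rabs_pos b). nra. }
      split.
      + apply Cderivable_plus; auto. apply (Cderivable_comp _ Clog); [|now apply Cderivable_Clog].
        apply Cderivable_div.
        * apply (Cderivable_comp (fun w => w * RtoC (INR (S j) / INR n))%C h).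
          -- apply (Cderivable_mult (fun w => w)); [apply Cderivable_id|apply Cderivable_const].
          -- apply Hh. lra.
        * apply (Cderivable_comp (fun w => w * RtoC (INR j / INR n))%C h).
          -- apply (Cderivable_mult (fun w => w)); [apply Cderivable_id|apply Cderivable_const].
          -- apply Hh. lra.
        * apply Hn. lra.
      + rewrite Cexp_plus, L2, Cexp_Clog by auto. field. apply Hn. lra. }
  destruct (Ind n (Nat.le_refl n)) as [l Hl].
  assert (H0 : Cexp (l 0) = h 0).
  { destruct (Hl 0) as [_ E]; [rewrite Cmod_0; lra|]. rewrite E. f_equal. ring. }
  exists (fun z => l z + (- l 0 + a))%C. split; [ring|].
  intros z Hz. destruct (Hl z Hz) as [L1 L2]. split.
  - apply Cderivable_plus; auto. apply Cderivable_const.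
  - rewrite !Cexp_plus, Cexp_opp, Ha, L2, H0.
    replace (z * RtoC (INR n / INR n))%C with z.
    + field. rewrite <- H0. apply Cexp_nz.
    + unfold Rdiv. rewrite Rinv_r by lra. ring.
Qed.

(** With [A = ln (2 + M)], the function [A - ln (1 - h / p)] has positive real part
    and value [A] at the origin, so Harnack bounds it from above; this is a lower
    bound for [|h - p|] that depends on [h] only through [M]. *)
Lemma omitted_value_distance (h : C -> C) (p : C) (R0 r1 r0 M k : R) :
  (forall z, Cmod z < R0 -> Cderivable h z) -> h 0 = 0 -> 0 < r0 < r1 -> r1 < R0 ->
  (forall z, Cmod z <= r1 -> Cmod (h z) <= M) ->
  Cmod p = 1 -> (forall z, Cmod z < R0 -> h z <> p) -> k < 1 ->
  forall z, Cmod z <= k * r0 -> exp (- (ln (2 + M) * (1 + k) / (1 - k))) <= Cmod (h z - p).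
Proof.
  intros Hh H0 Hr0 Hr1 HM Hp Hom Hk z Hz.
  assert (Np : p <> 0) by (apply Cmod_gt_0; lra).
  assert (HM0 : 0 <= M). { specialize (HM 0). rewrite H0, Cmod_0 in HM. lra. }
  set (A := ln (2 + M)). assert (HA : 0 < A) by (unfold A; rewrite <- ln_1; apply ln_increasing; lra).
  destruct (log_on_disc (fun w => 1 + - (h w / p))%C R0 r1 0) as [l [Hl0 Hl]]; auto; try lra.
  { intros w Hw. apply Cderivable_plus; [apply Cderivable_const|]. apply Cderivable_opp.
    apply Cderivable_div; auto. apply Cderivable_const. }
  { intros w Hw E. apply (Hom w Hw).
    replace (h w) with (p - p * (1 + - (h w / p)))%C by (field; auto). rewrite E. ring. }
  { rewrite H0, Cexp_0. field. auto. }
  assert (Md : forall w, Cmod w <= r1 -> exp (fst (l w)) = Cmod (h w - p)).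
  { intros w Hw. rewrite <- Cmod_Cexp. rewrite (proj2 (Hl w Hw)).
    replace (1 + - (h w / p))%C with ((p - h w) / p)%C by (field; auto).
    rewrite Cmod_div, Hp, Cmod_sub_sym by auto. field. }
  assert (Hkpos : 0 <= k). { assert (Q := Cmod_ge_0 z). nra. }
  assert (Hz1 : Cmod z <= r1) by nra.
  assert (Hg := harnack (fun w => RtoC A + - l w)%C r1 r0 k A).
  specialize (fun a b c d e f => Hg a b c d e f z Hz).
  rewrite <- Md by auto.
  assert (G : fst (RtoC A + - l z)%C * (1 - k) <= A * (1 + k)).
  { apply Hg; auto.
    - intros w Hw. apply Cderivable_plus; [apply Cderivable_const|]. apply Cderivable_opp. apply Hl. lra.
    - intros w Hw. change (0 <= A + - fst (l w)).
      assert (fst (l w) <= A).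
      { apply Rnot_lt_le. intros Hlt. apply exp_increasing in Hlt. apply Rlt_not_le in Hlt. apply Hlt.
        rewrite Md by lra. unfold A. rewrite exp_ln by lra.
        assert (T := Cmod_triangle (h w) (- p)). rewrite Cmod_opp, Hp in T.
        specialize (HM w ltac:(lra)). unfold Cminus. lra. }
      lra.
    - rewrite Hl0. ring. }
  change ((A + - fst (l z)) * (1 - k) <= A * (1 + k)) in G.
  destruct (Rle_or_lt (- (A * (1 + k) / (1 - k))) (fst (l z))) as [Hle|Hlt].
  - destruct Hle as [Hle| ->]; [left; now apply exp_increasing|lra].
  - exfalso. assert (E : A * (1 + k) / (1 - k) * (1 - k) = A * (1 + k)) by (field; lra). nra.
Qed.

(** * Landen iteration and the Hurwitz constant 16 *)

(** [ln (a / b)] is both [2 ln a - ln (a b)] and [ln (a b) - 2 ln b]; the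
    hypotheses bound [2 ln a] and [2 ln b] by [ln 6] plus the positive part of
    [ln (a b)]. *)
Lemma ln_quotient_bound (a b : R) :
  0 < a -> 0 < b -> a ^ 2 <= 6 * Rmax 1 (a * b) -> b ^ 2 <= 6 * Rmax 1 (a * b) ->
  Rabs (ln (a / b)) <= Rabs (ln (a * b)) + ln 6.
Proof.
  intros Ha Hb H1 H2.
  assert (Hab : 0 < a * b) by (apply Rmult_lt_0_compat; auto).
  assert (Hmax : 0 < Rmax 1 (a * b)) by (eapply Rlt_le_trans; [apply Rlt_0_1|apply Rmax_l]).
  assert (Lm : ln (Rmax 1 (a * b)) = Rmax 0 (ln (a * b))).
  { destruct (Rle_or_lt 1 (a * b)) as [H|H].
    - rewrite Rmax_right by auto. rewrite Rmax_right; auto. rewrite <- ln_1. apply ln_le; lra.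
    - rewrite Rmax_left by lra. rewrite Rmax_left; [apply ln_1|].
      rewrite <- ln_1. left. apply ln_increasing; lra. }
  assert (G : forall t, 0 < t -> t ^ 2 <= 6 * Rmax 1 (a * b) -> 2 * ln t <= ln 6 + Rmax 0 (ln (a * b))).
  { intros t Ht H. rewrite <- Lm, <- ln_mult by lra.
    replace (2 * ln t) with (ln (t ^ 2)) by (rewrite ln_pow; auto; simpl; ring).
    apply ln_le; auto. apply pow_lt; auto. }
  assert (G1 := G a Ha H1). assert (G2 := G b Hb H2).
  rewrite ln_div by auto. rewrite ln_mult in * by auto.
  assert (M : Rmax 0 (ln a + ln b) = (Rabs (ln a + ln b) + (ln a + ln b)) / 2).
  { destruct (Rle_or_lt 0 (ln a + ln b)).
    - rewrite Rmax_right, Rabs_pos_eq by lra. lra.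
    - rewrite Rmax_left, Rabs_left by lra. lra. }
  rewrite M in *.
  assert (B1 := RRle_abs (ln a + ln b)). assert (B2 := RRle_abs (- (ln a + ln b))).
  rewrite Rabs_Ropp in B2. apply Rabs_le. lra.
Qed.

(** The logarithmic size of [(1 - s) / (1 + s)] is controlled by that of
    [(1 - s) (1 + s)] whichever square root [s] of [1 - F] is taken.  This is what
    makes the iteration insensitive to the branch reached by analytic
    continuation. *)
Lemma sqrt_branch_growth (s : C) :
  (1 - s)%C <> 0 -> (1 + s)%C <> 0 ->
  Rabs (ln (Cmod ((1 - s) / (1 + s)))) <= Rabs (ln (Cmod (1 - s * s))) + ln 6.
Proof.
  intros N1 N2. apply Cmod_gt_0 in N1 as P1. apply Cmod_gt_0 in N2 as P2.
  rewrite Cmod_div by auto.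
  replace (1 - s * s)%C with ((1 - s) * (1 + s))%C by ring.
  assert (E : Cmod ((1 - s) * (1 + s)) = Cmod (1 - s) * Cmod (1 + s)) by apply Cmod_mult.
  rewrite E.
  assert (T1 := Cmod_triangle 1 (- s)). assert (T2 := Cmod_triangle 1 s).
  rewrite Cmod_opp in T1. rewrite Cmod_1 in T1, T2.
  assert (T3 := Cmod_rev_triangle (s * s) 1).
  replace (s * s - 1)%C with (- ((1 - s) * (1 + s)))%C in T3 by ring.
  rewrite Cmod_opp, E, Cmod_mult, Cmod_1 in T3.
  change (Cmod (1 + - s)) with (Cmod (1 - s)) in T1.
  assert (M1 := Rmax_l 1 (Cmod (1 - s) * Cmod (1 + s))).
  assert (M2 := Rmax_r 1 (Cmod (1 - s) * Cmod (1 + s))).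
  set (m := Rmax 1 (Cmod (1 - s) * Cmod (1 + s))) in *.
  assert (Q := Cmod_ge_0 s).
  assert (G : forall t, 0 < t -> t <= 1 + Cmod s -> t ^ 2 <= 6 * m).
  { intros t Ht Hts. assert (0 <= (1 - Cmod s) ^ 2) by apply pow2_ge_0.
    assert (t ^ 2 <= (1 + Cmod s) ^ 2) by (apply pow_incr; lra). nra. }
  apply ln_quotient_bound; auto.
Qed.

(** The class preserved by the Landen step; [c] is the derivative at the origin. *)
Definition omits_unity_roots (h : C -> C) (R0 : R) (N : nat) (c : C) : Prop :=
  (forall z, Cmod z < R0 -> Cderivable h z) /\ Cderiv h 0 c /\ h 0 = 0 /\
  (forall z : C, Cmod z < R0 -> z <> 0 -> h z <> 0) /\
  (forall z, Cmod z < R0 -> (h z ^ N)%C <> 1).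

(** For [N = 1] this is the passage from the nome [q] to [q^2] in the theory of
    the modular function, followed by a square root to keep the zero simple.
    Extracting [h] itself rather than [h^N] avoids dividing by the zero at the
    origin: only [1 + s], which has no zero, is raised to a fractional power.
    The radius shrinks because logarithms are taken on smaller discs. *)
Lemma landen_step (h : C -> C) (R0 R1 : R) (N : nat) (c : C) :
  (0 < N)%nat -> 0 < R1 < R0 -> omits_unity_roots h R0 N c ->
  exists h', omits_unity_roots h' R1 (2 * N) (c * RtoC (exp (- (2 * ln 2 / INR N)))) /\
    forall z : C, Cmod z < R1 -> z <> 0 ->
      Rabs (ln (Cmod (h' z))) <= Rabs (ln (Cmod (h z))) + ln 6 / INR N.
Proof.
  intros HN HR [Hh [Hc [H0 [Hnz Hom]]]].
  assert (HNR : 0 < INR N) by now apply lt_0_INR.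
  assert (P0 : (h 0 ^ N)%C = 0).
  { rewrite H0. destruct N; [lia|]. simpl. ring. }
  set (R2 := (R0 + R1) / 2).
  destruct (log_on_disc (fun z => 1 - h z ^ N)%C R0 R2 0) as [l [Hl0 Hl]].
  { intros z Hz. apply Cderivable_minus; [apply Cderivable_const|]. apply Cderivable_pow; auto. }
  { intros z Hz E. apply (Hom z Hz). symmetry. now apply Ceq_sub0. }
  { unfold R2; lra. }
  { rewrite P0, Cexp_0. ring. }
  set (s := fun z => Cexp (l z * RtoC (1/2))).
  assert (Hs : forall z, Cmod z <= R2 -> (s z * s z)%C = (1 - h z ^ N)%C).
  { intros z Hz. unfold s. rewrite <- Cexp_plus, <- (proj2 (Hl z Hz)). f_equal.
    rewrite <- Cmult_plus_distr_l, <- RtoC_plus. replace (1 / 2 + 1 / 2) with 1 by lra. ring. }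
  assert (Hs0 : s 0 = 1).
  { unfold s. rewrite Hl0, Cmult_0_l. apply Cexp_0. }
  (* If [s z = -1] then [h z = 0], so [z = 0], where [s] is 1. *)
  assert (Ns : forall z, Cmod z < R2 -> (1 + s z)%C <> 0).
  { intros z Hz E. assert (S := Hs z ltac:(lra)).
    assert (Es : s z = (- (1))%C). { replace (s z) with (1 + s z - 1)%C by ring. rewrite E. ring. }
    assert (Eh : (h z ^ N)%C = 0).
    { replace (h z ^ N)%C with (1 - (1 - h z ^ N))%C by ring. rewrite <- S, Es. ring. }
    destruct (excluded_middle_informative (z = 0)) as [->|Nz].
    - rewrite Hs0 in E. apply (f_equal fst) in E. simpl in E. lra.
    - apply (Cpow_nz (h z) N); auto. apply Hnz; auto. unfold R2 in Hz; lra. }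
  (* The value [ln 2] at the origin makes the derivative come out as a positive
     multiple of [c]. *)
  destruct (log_on_disc (fun z => 1 + s z)%C R2 R1 (RtoC (ln 2))) as [m [Hm0 Hm]]; auto.
  { intros z Hz. apply Cderivable_plus; [apply Cderivable_const|]. apply Cderivable_exp.
    apply Cderivable_mult; [apply Hl; lra|apply Cderivable_const]. }
  { unfold R2; lra. }
  { rewrite Hs0, Cexp_RtoC, exp_ln by lra. rewrite <- RtoC_plus. f_equal; lra. }
  set (E := fun z => Cexp (m z * RtoC (- (2 / INR N)))).
  set (h' := fun z => (h z * E z)%C).
  assert (HE : forall z, Cmod z < R1 -> Cderivable E z).
  { intros z Hz. apply Cderivable_exp. apply Cderivable_mult; [apply Hm; lra|apply Cderivable_const]. }
  assert (HEN : forall z, Cmod z < R1 -> (E z ^ N)%C = (/ ((1 + s z) * (1 + s z)))%C).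
  { intros z Hz. unfold E. rewrite Cexp_pow, <- (proj2 (Hm z ltac:(lra))), <- Cexp_plus, <- Cexp_opp.
    f_equal. rewrite (Cmult_comm (m z)), Cmult_assoc, <- RtoC_mult.
    replace (INR N * - (2 / INR N)) with (- (1 + 1)) by (field; lra).
    rewrite RtoC_opp, RtoC_plus. ring. }
  assert (HhN : forall z, Cmod z < R1 -> (h' z ^ N)%C = ((1 - s z) / (1 + s z))%C).
  { intros z Hz. unfold h'. rewrite Cpow_mult_l, HEN by auto.
    replace (h z ^ N)%C with (1 - s z * s z)%C.
    - field. apply Ns. unfold R2; lra.
    - rewrite Hs by (unfold R2; lra). ring. }
  assert (Hd : Cderiv h' 0 (c * RtoC (exp (- (2 * ln 2 / INR N))))).
  { destruct (HE 0) as [e He]; [rewrite Cmod_0; lra|].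
    assert (D := Cderiv_mult h E 0 c e Hc He). fold h' in D. rewrite H0 in D.
    replace (c * RtoC (exp (- (2 * ln 2 / INR N))))%C with (c * E 0 + 0 * e)%C; auto.
    unfold E. rewrite Hm0, <- RtoC_mult, Cexp_RtoC.
    replace (ln 2 * - (2 / INR N)) with (- (2 * ln 2 / INR N)) by (field; lra). ring. }
  exists h'. split; [split; [|split; [|split; [|split]]]|]; auto.
  - intros z Hz. apply Cderivable_mult; auto. apply Hh; lra.
  - unfold h'. rewrite H0. ring.
  - intros z Hz Nz. apply Cmult_neq_0; [apply Hnz; auto; lra|apply Cexp_nz].
  - intros z Hz Eq. replace (2 * N)%nat with (N + N)%nat in Eq by lia.
    rewrite Cpow_add_r, HhN in Eq by auto.
    assert (N2 := Ns z ltac:(unfold R2; lra)).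
    (* The square of [(1 - s) / (1 + s)] is 1 only if [s = 0], but [s] is an exponential. *)
    assert (F : (4 * s z)%C = 0).
    { replace (4 * s z)%C with ((1 + s z) * (1 + s z) * (1 - (1 - s z) / (1 + s z) * ((1 - s z) / (1 + s z))))%C
        by (field; auto). rewrite Eq. ring. }
    apply (Cexp_nz (l z * RtoC (1/2))). fold (s z).
    replace (s z) with (RtoC (/4) * (4 * s z))%C.
    + rewrite F. ring.
    + rewrite Cmult_assoc, <- RtoC_mult. replace (/ 4 * 4) with 1 by field. ring.
  - intros z Hz Nz.
    assert (Nh : h z <> 0) by (apply Hnz; auto; lra).
    assert (Nh' : h' z <> 0) by (apply Cmult_neq_0; auto; apply Cexp_nz).
    assert (N2 := Ns z ltac:(unfold R2; lra)).
    assert (N1 : (1 - s z)%C <> 0).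
    { intros E1. assert (Eq := HhN z Hz). rewrite E1 in Eq.
      apply (Cpow_nz (h' z) N); auto. rewrite Eq. unfold Cdiv. ring. }
    assert (G := sqrt_branch_growth (s z) N1 N2).
    rewrite <- HhN, Hs in G by (auto; unfold R2; lra).
    replace (1 - (1 - h z ^ N))%C with (h z ^ N)%C in G by ring.
    rewrite !Cmod_pow, !ln_pow in G by (apply Cmod_gt_0; auto).
    rewrite !Rabs_mult, (Rabs_pos_eq (INR N)) in G by lra.
    apply Rmult_le_reg_l with (INR N); auto.
    replace (INR N * (Rabs (ln (Cmod (h z))) + ln 6 / INR N)) with
      (INR N * Rabs (ln (Cmod (h z))) + ln 6) by (field; lra). auto.
Qed.

(** [2 - 2 / 2^k] is the sum of [1 / 2^j] over [j < k]. *)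
Lemma landen_iterate (f : C -> C) (c : C) :
  omits_unity_roots f 1 1 c ->
  forall k R0, 0 < R0 < 1 ->
  exists h, omits_unity_roots h R0 (2 ^ k) (c * RtoC (exp (- (2 * ln 2 * (2 - 2 / 2 ^ k))))) /\
    forall z : C, Cmod z < R0 -> z <> 0 ->
      Rabs (ln (Cmod (h z))) <= Rabs (ln (Cmod (f z))) + ln 6 * (2 - 2 / 2 ^ k).
Proof.
  intros Hf. induction k; intros R0 HR.
  - exists f. destruct Hf as [A1 [A2 [A3 [A4 A5]]]]. simpl pow.
    replace (2 - 2 / 1) with 0 by field. rewrite !Rmult_0_r, Ropp_0, exp_0, Cmult_1_r.
    split; [split; [|split; [|split; [|split]]]|]; auto.
    + intros z Hz. apply A1. lra.
    + intros z Hz. apply A4. lra.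
    + intros z Hz. apply A5. lra.
    + intros. lra.
  - destruct (IHk ((1 + R0) / 2)) as [h [Hh Hb]]; [lra|].
    assert (P2 : 0 < 2 ^ k) by (apply pow_lt; lra).
    assert (EI : INR (2 ^ k) = 2 ^ k) by (rewrite pow_INR; reflexivity).
    destruct (landen_step h ((1 + R0) / 2) R0 (2 ^ k) _ ltac:(apply Nat.neq_0_lt_0, Nat.pow_nonzero; lia) ltac:(lra) Hh)
      as [h' [Hh' Hb']].
    assert (Ek : 2 - 2 / 2 ^ S k = 2 - 2 / 2 ^ k + 1 / 2 ^ k) by (simpl; field; lra).
    exists h'. rewrite Ek. split.
    + rewrite <- Cmult_assoc, <- RtoC_mult, <- exp_plus, EI in Hh'.
      replace (- (2 * ln 2 * (2 - 2 / 2 ^ k + 1 / 2 ^ k))) with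
        (- (2 * ln 2 * (2 - 2 / 2 ^ k)) + - (2 * ln 2 / 2 ^ k)) by (field; lra).
      exact Hh'.
    + intros z Hz Nz. specialize (Hb z ltac:(lra) Nz). specialize (Hb' z Hz Nz). rewrite EI in Hb'.
      replace (ln 6 * (2 - 2 / 2 ^ k + 1 / 2 ^ k)) with (ln 6 * (2 - 2 / 2 ^ k) + ln 6 / 2 ^ k) by (field; lra).
      lra.
Qed.

Lemma Cexp_2PI_Z (j : Z) : Cexp (0, 2 * PI * IZR j) = 1.
Proof.
  assert (E : Cexp (0, 2 * PI) = 1).
  { unfold Cexp; simpl. rewrite exp_0, cos_2PI, sin_2PI. unfold RtoC. f_equal; ring. }
  assert (Nn : forall n : nat, Cexp (0, 2 * PI * INR n) = 1).
  { intros n. replace ((0, 2 * PI * INR n) : C) with (RtoC (INR n) * (0%R, (2 * PI)%R))%C.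
    - rewrite <- Cexp_pow, E. apply Cpow_1_l.
    - unfold Cmult, RtoC; simpl. f_equal; ring. }
  destruct (Z.le_ge_cases 0 j) as [H|H].
  - rewrite <- (Z2Nat.id j) by auto. rewrite <- INR_IZR_INZ. apply Nn.
  - replace ((0, 2 * PI * IZR j) : C) with (- (0%R, (2 * PI * INR (Z.to_nat (- j)))%R))%C.
    + rewrite Cexp_opp, Nn, <- RtoC_inv, Rinv_1 by lra. reflexivity.
    + rewrite INR_IZR_INZ, Z2Nat.id, opp_IZR by lia. unfold Copp; simpl. f_equal; ring.
Qed.

(** Round the argument down to a multiple of [2 pi / N]; a chord is shorter than
    its arc. *)
Lemma near_root_of_unity (w : C) (N : nat) :
  (0 < N)%nat -> Cmod w = 1 -> exists p : C, Cmod p = 1 /\ (p ^ N)%C = 1 /\ Cmod (w - p) <= 2 * PI / INR N.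
Proof.
  intros HN Hw. assert (HNR : 1 <= INR N) by (apply (le_INR 1); lia).
  assert (Pi := PI_RGT_0).
  destruct (Clog_exists w) as [[t al] Hl]; [apply Cmod_gt_0; lra|].
  assert (Et : t = 0).
  { apply exp_inv. rewrite exp_0. rewrite <- Hw, <- Hl, Cmod_Cexp. reflexivity. }
  subst t. set (x := al * INR N / (2 * PI)).
  destruct (base_Int_part x) as [I1 I2]. set (j := Int_part x) in *.
  set (be := 2 * PI * IZR j / INR N). set (de := al - be).
  assert (Ed : de = (x - IZR j) * (2 * PI / INR N)).
  { unfold de, be, x. field. lra. }
  assert (U : 0 < 2 * PI / INR N) by (apply Rdiv_lt_0_compat; lra).
  assert (D1 : 0 <= de) by (rewrite Ed; apply Rmult_le_pos; lra).
  assert (D2 : de <= 2 * PI / INR N).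
  { rewrite Ed. rewrite <- (Rmult_1_l (2 * PI / INR N)) at 2. apply Rmult_le_compat_r; lra. }
  assert (D3 : 2 * PI / INR N <= 2 * PI).
  { apply Rmult_le_reg_r with (INR N); [lra|]. unfold Rdiv. rewrite Rmult_assoc, Rinv_l, Rmult_1_r by lra. nra. }
  assert (Mp : Cmod (Cexp (0, be)) = 1) by (rewrite Cmod_Cexp; apply exp_0).
  exists (Cexp (0, be)). split; auto. split.
  - rewrite Cexp_pow. rewrite <- (Cexp_2PI_Z j). f_equal. unfold Cmult, RtoC, be; simpl. f_equal; field; lra.
  - rewrite <- Hl. replace ((0, al) : C) with ((0%R, be) + (0%R, de))%C.
    2:{ unfold Cplus, de; simpl. f_equal; ring. }
    rewrite Cexp_plus.
    replace (Cexp (0%R, be) * Cexp (0%R, de) - Cexp (0, be))%C with (Cexp (0, be) * (Cexp (0, de) - 1))%C by ring.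
    rewrite Cmod_mult, Mp, Rmult_1_l. apply Rle_trans with de; auto.
    apply Rsqr_incr_0; auto; try apply Cmod_ge_0. rewrite !Rsqr_pow2, Cmod_sq.
    unfold Cexp, Cminus, Cplus, Copp, RtoC; simpl. rewrite exp_0.
    assert (S1 : 0 <= sin (de / 2)) by (apply sin_ge_0; lra).
    assert (S2 : sin (de / 2) <= de / 2).
    { destruct D1 as [D1|D1]; [left; apply sin_lt_x; lra|]. rewrite <- D1.
      replace (0 / 2) with 0 by field. rewrite sin_0. lra. }
    assert (C1 : cos de = 1 - 2 * sin (de / 2) * sin (de / 2)).
    { rewrite <- cos_2a_sin. f_equal. field. }
    assert (C2 := sin2_cos2 de). unfold Rsqr in C2. nra.
Qed.

(** It suffices to prove [|c| r <= 16] for each [r < 1].  The radii are ordered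
    [r < r0 < r1 < R0 < 1]: the iterates live on [R0], are bounded on the circle
    [r1], and Harnack is applied on [r0]. *)
Theorem hurwitz_one_sixteenth (f : C -> C) (c : C) :
  (forall z, Cmod z < 1 -> Cderivable f z) -> Cderiv f 0 c -> f 0 = 0 ->
  (forall z : C, Cmod z < 1 -> z <> 0 -> f z <> 0) ->
  (forall z, Cmod z < 1 -> f z <> 1) -> Cmod c <= 16.
Proof.
  intros Hf Hc H0 Hnz Hom.
  assert (Hom1 : omits_unity_roots f 1 1 c).
  { split; [|split; [|split; [|split]]]; auto. intros z Hz. rewrite Cpow_1_r. auto. }
  assert (Main : forall r, 0 < r < 1 -> Cmod c * r <= 16).
  2:{ apply Rnot_lt_le. intros Hlt. assert (P : 0 < Cmod c) by lra.
      assert (Q1 : 16 / Cmod c < 1).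
      { apply Rmult_lt_reg_r with (Cmod c); auto. unfold Rdiv. rewrite Rmult_assoc, Rinv_l by lra. lra. }
      assert (Q2 : 0 < 16 / Cmod c) by (apply Rdiv_lt_0_compat; lra).
      specialize (Main ((1 + 16 / Cmod c) / 2) ltac:(lra)).
      assert (Cmod c * (16 / Cmod c) = 16) by (field; lra). nra. }
  intros r Hr.
  set (r1 := (1 + r) / 2). set (r0 := (r + r1) / 2). set (R0 := (1 + r1) / 2).
  assert (O1 : 0 < r0 < r1) by (unfold r0, r1; lra). assert (O2 : r1 < R0 < 1) by (unfold R0, r1; lra).
  assert (O3 : r < r0) by (unfold r0, r1; lra).
  destruct (disc_compact (fun z b => Cmod z = r1 -> Rabs (ln (Cmod (f z))) <= b) r1) as [B HB].
  { intros z b b' Hbb H E. specialize (H E). lra. }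
  { intros z Hz. destruct (excluded_middle_informative (z = 0)) as [->|N].
    (* Points close to the origin do not lie on the circle of radius [r1]. *)
    - exists r1, 0. split; [lra|]. intros z' _ D E. replace (z' - 0)%C with z' in D by ring. lra.
    - assert (Nf := Hnz z ltac:(lra) N). apply Cmod_gt_0 in Nf as P.
      destruct (Cderivable_cts _ _ (Hf z ltac:(lra)) (Cmod (f z) / 2)) as [d [Hd K]]; [lra|].
      exists d, (Rabs (ln (Cmod (f z))) + ln 2). split; auto. intros z' Hz' D _.
      specialize (K z' D).
      assert (T1 := Cmod_rev_triangle (f z') (f z)). assert (T2 := Cmod_rev_triangle (f z) (f z')).
      rewrite (Cmod_sub_sym (f z)) in T2.
      assert (U1 : ln (Cmod (f z')) <= ln (Cmod (f z)) + ln 2).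
      { rewrite <- ln_mult by lra. apply ln_le; lra. }
      assert (U2 : ln (Cmod (f z)) <= ln (Cmod (f z')) + ln 2).
      { rewrite <- ln_mult by lra. apply ln_le; lra. }
      assert (A1 := RRle_abs (ln (Cmod (f z)))). assert (A2 := RRle_abs (- ln (Cmod (f z)))).
      rewrite Rabs_Ropp in A2. apply Rabs_le. lra. }
  (* [2 ln 6] is the sum of all the increments [(ln 6) / 2^j]. *)
  set (M := exp (B + 2 * ln 6)).
  set (k := r / r0).
  assert (Hk : k < 1).
  { unfold k. apply Rmult_lt_reg_r with r0; [lra|]. unfold Rdiv. rewrite Rmult_assoc, Rinv_l by lra. lra. }
  set (eps := exp (- (ln (2 + M) * (1 + k) / (1 - k)))).
  destruct (small_pow (2 * PI) eps) as [n Hn]; [apply exp_pos|].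
  destruct (landen_iterate f c Hom1 n R0 ltac:(lra)) as [h [[Hh [Hd [Hh0 [Hhnz Hhom]]]] Hb]].
  assert (P2 : 0 < 2 / 2 ^ n) by (apply Rdiv_lt_0_compat; [lra|apply pow_lt; lra]).
  assert (Hl6 : 0 < ln 6) by (rewrite <- ln_1; apply ln_increasing; lra).
  assert (HM : forall z, Cmod z <= r1 -> Cmod (h z) <= M).
  { apply max_principle with (R0 := R0); try lra.
    - intros z Hz. apply Hh. lra.
    - apply Cderivable_cts, Hh. rewrite Cmod_0. lra.
    - intros z Hz. assert (N : z <> 0) by (apply Cmod_gt_0; lra).
      specialize (Hb z ltac:(lra) N). specialize (HB z ltac:(lra) Hz).
      assert (P := proj1 (Cmod_gt_0 _) (Hhnz z ltac:(lra) N)).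
      assert (A := RRle_abs (ln (Cmod (h z)))).
      assert (L : ln (Cmod (h z)) <= B + 2 * ln 6) by nra.
      rewrite <- (exp_ln (Cmod (h z))) by auto. unfold M.
      destruct L as [L| ->]; [left; now apply exp_increasing|lra]. }
  (* A value on the unit circle would be closer than [eps] to an omitted root of unity. *)
  assert (NoOne : forall z, Cmod z <= r -> Cmod (h z) <> 1).
  { intros z Hz E.
    destruct (near_root_of_unity (h z) (2 ^ n)) as [p [Hp1 [HpN Hp]]]; auto.
    { apply Nat.neq_0_lt_0, Nat.pow_nonzero; lia. }
    rewrite pow_INR in Hp. change (INR 2) with 2 in Hp.
    assert (L := omitted_value_distance h p R0 r1 r0 M k Hh Hh0 ltac:(lra) ltac:(lra) HM Hp1).
    specialize (fun H => L H Hk z). fold eps in L.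
    assert (eps <= Cmod (h z - p)).
    { apply L.
      - intros w Hw Ew. apply (Hhom w Hw). now rewrite Ew.
      - unfold k. unfold Rdiv. rewrite Rmult_assoc, Rinv_l by lra. lra. }
    lra. }
  (* Along the segment from 0 to [z], [|h|] cannot pass the value 1. *)
  assert (Lt1 : forall z, Cmod z <= r -> Cmod (h z) <= 1).
  { intros z Hz. apply Rnot_lt_le. intros Hlt.
    assert (Cm : forall t, 0 <= t <= 1 -> Cmod (RtoC t * z) <= Cmod z).
    { intros t Ht. rewrite Cmod_mult, Cmod_R, Rabs_pos_eq by lra. assert (Q := Cmod_ge_0 z). nra. }
    destruct (f_interv_is_interv (fun t => Cmod (h (RtoC t * z)%C)) 0 1 1) as [t [Ht Et]].
    - lra.
    - rewrite Cmult_0_l, Hh0, Cmod_0, Cmult_1_l. lra.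
    - intros t Ht e He.
      destruct (Cderivable_cts _ _ (Hh (RtoC t * z)%C ltac:(specialize (Cm t Ht); lra)) e He) as [d [Hd' K]].
      exists (d / (Cmod z + 1)). assert (Q := Cmod_ge_0 z). split; [apply Rdiv_lt_0_compat; lra|].
      intros t' [_ Dt]. simpl in *. unfold R_dist in *.
      assert (K' : Cmod (h (RtoC t' * z)%C - h (RtoC t * z)%C) < e).
      { apply K. replace (RtoC t' * z - RtoC t * z)%C with (RtoC (t' - t) * z)%C by (rewrite RtoC_minus; ring).
        rewrite Cmod_mult, Cmod_R.
        apply Rmult_lt_compat_r with (r := Cmod z + 1) in Dt; [|lra].
        unfold Rdiv in Dt. rewrite Rmult_assoc, Rinv_l, Rmult_1_r in Dt by lra.
        assert (Q' := Rabs_pos (t' - t)). nra. }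
      assert (T1 := Cmod_rev_triangle (h (RtoC t' * z)%C) (h (RtoC t * z)%C)).
      assert (T2 := Cmod_rev_triangle (h (RtoC t * z)%C) (h (RtoC t' * z)%C)).
      rewrite (Cmod_sub_sym (h (RtoC t * z)%C)) in T2. apply Rabs_def1; lra.
    - apply (NoOne (RtoC t * z)%C); auto. specialize (Cm t Ht). lra. }
  destruct (schwarz h R0 r 1 _ Hh Hd Hh0 ltac:(lra)) as [S _].
  { intros z Hz. apply Lt1. lra. }
  rewrite Cmod_mult, Cmod_R, Rabs_pos_eq in S by (left; apply exp_pos).
  assert (Hl2 : 0 < ln 2) by (rewrite <- ln_1; apply ln_increasing; lra).
  assert (E16 : / 16 <= exp (- (2 * ln 2 * (2 - 2 / 2 ^ n)))).
  { replace (/ 16) with (exp (- (4 * ln 2))).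
    - left. apply exp_increasing. nra.
    - rewrite exp_Ropp. f_equal. replace (4 * ln 2) with (ln (2 ^ 4)) by (rewrite ln_pow by lra; simpl; ring).
      rewrite exp_ln; lra. }
  assert (Q := Cmod_ge_0 c).
  assert (S' : Cmod c * / 16 <= 1 / r).
  { eapply Rle_trans; [|exact S]. apply Rmult_le_compat_l; auto. }
  apply Rmult_le_compat_r with (r := r) in S'; [|lra].
  replace (1 / r * r) with 1 in S' by (field; lra). lra.
Qed.

(** * Hurwitz densities *)

Lemma open_disc_C (Om : C -> Prop) (w : C) :
  open Om -> Om w -> exists d, 0 < d /\ forall z, Cmod (z - w) < d -> Om z.
Proof.
  intros Ho Hw. destruct (Ho w Hw) as [d Hd]. exists d. split; [apply cond_pos|].
  intros z Hz. apply Hd. apply C_NormedModule_mixin_compat1. exact Hz.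
Qed.

(** Hurwitz's theorem for [(f - w) / (w1 - w)]. *)
Lemma hurwitz_derivative_le (Om : C -> Prop) (w w1 : C) (r : R) :
  hurwitz_derivatives Om w r -> ~ Om w1 -> r <= 16 * Cmod (w1 - w).
Proof.
  intros [f [[Hf [HOm [H0 [Hne _]]]] Hd]] Hw1.
  assert (D0 : unit_disc 0) by (unfold unit_disc; rewrite Cmod_0; lra).
  assert (N : (w1 - w)%C <> 0).
  { intros E. apply Hw1. rewrite (Ceq_sub0 _ _ E), <- H0. auto. }
  assert (P := proj1 (Cmod_gt_0 _) N).
  assert (B : Cmod (/ (w1 - w) * RtoC r) <= 16).
  { apply (hurwitz_one_sixteenth (fun z => / (w1 - w) * (f z + - w))%C).
    - intros z Hz. apply Cderivable_mult; [apply Cderivable_const|]. apply Cderivable_plus; [|apply Cderivable_const].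
      destruct (Hf z Hz) as [l Hl]. exists l. now apply Cderiv_of_is_derive.
    - replace (/ (w1 - w) * RtoC r)%C with (0 * (f 0 + - w) + / (w1 - w) * (RtoC r + 0))%C by ring.
      apply (Cderiv_mult (fun _ => / (w1 - w))%C (fun z => f z + - w)%C); [apply Cderiv_const|].
      apply Cderiv_plus; [now apply Cderiv_of_is_derive|apply Cderiv_const].
    - rewrite H0. ring.
    - intros z Hz Nz E. apply (Hne z Hz Nz).
      replace (f z) with ((w1 - w) * (/ (w1 - w) * (f z + - w)) + w)%C by (field; auto).
      rewrite E. ring.
    - intros z Hz E. apply Hw1.
      replace w1 with ((w1 - w) * 1 + w)%C by ring. rewrite <- E.
      replace ((w1 - w) * (/ (w1 - w) * (f z + - w)) + w)%C with (f z) by (field; auto). auto. }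
  rewrite Cmod_mult, Cmod_inv, Cmod_R in B by auto.
  apply Rmult_le_compat_l with (r := Cmod (w1 - w)) in B; [|lra].
  rewrite <- Rmult_assoc, Rinv_r, Rmult_1_l in B by lra.
  assert (A := RRle_abs r). lra.
Qed.

Lemma is_derive_affine (a b z : C) :
  is_derive (K := C_AbsRing) (V := C_NormedModule) (fun y => (a + b * y)%C) z b.
Proof.
  split; [apply is_linear_scal_l|]. intros x Hx.
  apply (is_filter_lim_locally_unique (V := AbsRing_NormedModule C_AbsRing)) in Hx.
  subst x. intros e.
  apply filter_forall. intros y.
  change (Cmod ((a + b * y) - (a + b * z) - (y - z) * b)%C <= e * Cmod (y - z)).
  replace ((a + b * y) - (a + b * z) - (y - z) * b)%C with (RtoC 0) by ring.
  rewrite Cmod_0. apply Rmult_le_pos; [left; apply cond_pos|apply Cmod_ge_0].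
Qed.

Lemma hurwitz_derivative_of_disc (Om : C -> Prop) (w : C) (d : R) :
  0 < d -> (forall z, Cmod (z - w) < d -> Om z) -> hurwitz_derivatives Om w d.
Proof.
  intros Hd HOm. exists (fun z => (w + RtoC d * z)%C).
  assert (D : forall z, is_derive (K := C_AbsRing) (V := C_NormedModule) (fun y => (w + RtoC d * y)%C) z (RtoC d))
    by (intros z; apply is_derive_affine).
  split; [|apply D]. split; [|split; [|split; [|split]]].
  - intros z _. exists (RtoC d). apply D.
  - intros z Hz. apply HOm. replace (w + RtoC d * z - w)%C with (RtoC d * z)%C by ring.
    rewrite Cmod_mult, Cmod_R, Rabs_pos_eq by lra. unfold unit_disc in Hz. nra.
  - ring.
  - intros s _ Ns E. apply Ns.
    assert (E2 : (RtoC d * s)%C = 0) by (replace (RtoC d * s)%C with (w + RtoC d * s - w)%C by ring; rewrite E; ring).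
    apply Cmod_eq_0. assert (E3 := f_equal Cmod E2). rewrite Cmod_mult, Cmod_R, Rabs_pos_eq, Cmod_0 in E3 by lra.
    nra.
  - exists d. split; auto. apply D.
Qed.

(** A disc in [Om] bounds the radius from below and an omitted point bounds it from
    above, so that the extended real supremum and the projections in the density
    are ordinary real numbers. *)
Lemma hurwitz_radius_finite (Om : C -> Prop) (w w1 : C) (d : R) :
  ~ Om w1 -> 0 < d -> hurwitz_derivatives Om w d ->
  exists rho, 0 < rho /\ rho <= 16 * Cmod (w1 - w) /\ hurwitz_density Om w = 2 / rho /\
    (forall r, hurwitz_derivatives Om w r -> r <= rho) /\
    (forall b, (forall r, hurwitz_derivatives Om w r -> r <= b) -> rho <= b).
Proof.
  intros Hw1 Hd HE.
  assert (L := Lub_Rbar_correct (hurwitz_derivatives Om w)). destruct L as [Hub Hl].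
  assert (B : Rbar_le (Lub_Rbar (hurwitz_derivatives Om w)) (16 * Cmod (w1 - w))).
  { apply Hl. intros r Hr. simpl. eapply hurwitz_derivative_le; eauto. }
  assert (A := Hub d HE).
  unfold hurwitz_density, hurwitz_radius.
  destruct (Lub_Rbar (hurwitz_derivatives Om w)) as [rho| |]; simpl in A, B; try tauto.
  exists rho. repeat split; auto; try lra.
  - intros b Hb. apply (Hl (Finite b)). intros r Hr. apply Hb, Hr.
Qed.

Lemma hurwitz_derivatives_mono (Om Om' : C -> Prop) (w : C) (r : R) :
  (forall z, Om z -> Om' z) -> hurwitz_derivatives Om w r -> hurwitz_derivatives Om' w r.
Proof.
  intros H [f [[H1 [H2 H3]] Hd]]. exists f. split; auto. split; auto.
Qed.

Lemma omits_two_points (Om : C -> Prop) (w1 w2 : C) :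
  ~ Om w1 -> ~ Om w2 -> forall z, Om z -> twice_punctured_plane w1 w2 z.
Proof. intros H1 H2 z Hz. split; intros ->; auto. Qed.

Lemma not_twice_punctured_l (w1 w2 : C) : ~ twice_punctured_plane w1 w2 w1.
Proof. intros [H _]. now apply H. Qed.

(** A smaller domain has fewer admissible maps, hence a smaller radius and a larger
    density. *)
Lemma density_bar_le_density (Om : C -> Prop) (w : C) :
  open Om -> hyperbolic Om -> Om w ->
  Rbar_le (hurwitz_density_bar Om w) (Finite (hurwitz_density Om w)).
Proof.
  intros Ho [p [_ [_ [Hp _]]]] Hw.
  destruct (open_disc_C Om w Ho Hw) as [d [Hd HD]].
  assert (E := hurwitz_derivative_of_disc Om w d Hd HD).
  destruct (hurwitz_radius_finite Om w p d Hp Hd E) as [rho [Hrho [_ [-> [_ Hl]]]]].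
  apply (proj2 (Lub_Rbar_correct _)). intros x [w1 [w2 [N [H1 [H2 ->]]]]].
  assert (Sub := omits_two_points Om w1 w2 H1 H2).
  assert (E' := hurwitz_derivatives_mono Om _ w d Sub E).
  destruct (hurwitz_radius_finite _ w w1 d (not_twice_punctured_l w1 w2) Hd E')
    as [rho' [Hrho' [_ [-> [Hub' _]]]]].
  simpl. apply Rmult_le_compat_l; [lra|]. apply Rinv_le_contravar; auto.
  apply Hl. intros r Hr. apply Hub'. eapply hurwitz_derivatives_mono; eauto.
Qed.

(** No nearest point of the complement has to be chosen: the bound
    [1 / (8 |w1 - w|) <= b] for all omitted [w1] already puts a disc of radius
    [1 / (8 b)] inside [Om]. *)
Lemma density_le_16_density_bar (Om : C -> Prop) (w : C) :
  open Om -> hyperbolic Om -> Om w ->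
  Rbar_le (Finite (hurwitz_density Om w / 16)) (hurwitz_density_bar Om w).
Proof.
  intros Ho [p1 [p2 [Np [Hp1 Hp2]]]] Hw.
  destruct (open_disc_C Om w Ho Hw) as [d [Hd HD]].
  assert (E := hurwitz_derivative_of_disc Om w d Hd HD).
  assert (K : forall w1, ~ Om w1 -> Rbar_le (Finite (/ (8 * Cmod (w1 - w)))) (hurwitz_density_bar Om w)).
  { intros w1 H1.
    assert (exists w2, w1 <> w2 /\ ~ Om w2) as [w2 [N12 H2]].
    { destruct (excluded_middle_informative (w1 = p1)) as [->|N]; [exists p2|exists p1]; auto. }
    assert (E' := hurwitz_derivatives_mono Om _ w d (omits_two_points Om w1 w2 H1 H2) E).
    destruct (hurwitz_radius_finite _ w w1 d (not_twice_punctured_l w1 w2) Hd E')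
      as [rho' [Hrho' [Hle [Heq _]]]].
    apply Rbar_le_trans with (Finite (2 / rho')).
    - simpl. assert (P : 0 < Cmod (w1 - w)) by lra.
      replace (/ (8 * Cmod (w1 - w))) with (2 * / (16 * Cmod (w1 - w))) by (field; lra).
      apply Rmult_le_compat_l; [lra|]. now apply Rinv_le_contravar.
    - apply (proj1 (Lub_Rbar_correct _)). exists w1, w2. auto. }
  destruct (hurwitz_radius_finite Om w p1 d Hp1 Hd E) as [rho [Hrho [_ [-> [Hub _]]]]].
  assert (Dist : forall q, ~ Om q -> 0 < Cmod (q - w)).
  { intros q Hq. apply Cmod_gt_0. intros Z. apply Hq. now rewrite (Ceq_sub0 _ _ Z). }
  destruct (hurwitz_density_bar Om w) as [b| |]; simpl in *; auto.
  - assert (Hb : 0 < b).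
    { specialize (K p1 Hp1). specialize (Dist p1 Hp1).
      assert (0 < / (8 * Cmod (p1 - w))) by (apply Rinv_0_lt_compat; lra). lra. }
    assert (L : / (8 * b) <= rho).
    { apply Hub. apply hurwitz_derivative_of_disc; [apply Rinv_0_lt_compat; lra|].
      intros z Hz. apply NNPP. intros Nz. specialize (K z Nz). specialize (Dist z Nz).
      apply Rmult_lt_compat_l with (r := 8 * b) in Hz; [|lra]. rewrite Rinv_r in Hz by lra.
      apply Rmult_le_compat_l with (r := 8 * Cmod (z - w)) in K; [|lra]. rewrite Rinv_r in K by lra. lra. }
    apply Rmult_le_compat_l with (r := 8 * b) in L; [|lra]. rewrite Rinv_r in L by lra.
    apply Rmult_le_reg_r with (16 * rho); [lra|].
    replace (2 / rho / 16 * (16 * rho)) with 2 by (field; lra). lra.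
  - exact (K p1 Hp1).
Qed.

(** Follow the path up to the supremum [m] of the times before which it stays in
    [U]; whichever of [U], [V] contains the point at time [m], there is a common
    point nearby.  Paths are restrictions to [0, 1] of continuous maps of the
    plane. *)
Lemma connected_of_paths (A : C -> Prop) :
  (forall z1 z2, A z1 -> A z2 -> exists G : C -> C,
     G 0 = z1 /\ G 1 = z2 /\ (forall t, 0 <= t <= 1 -> A (G (RtoC t))) /\
     (forall z, Ccont G z)) ->
  connected_set A.
Proof.
  intros HP U V HU HV Cov [z1 [A1 U1]] [z2 [A2 V2]].
  apply NNPP. intros Dis.
  destruct (HP z1 z2 A1 A2) as [G [G0 [G1 [GA Gc]]]].
  set (g := fun t => G (RtoC t)).
  change (g 0 = z1) in G0. change (g 1 = z2) in G1.
  change (forall t, 0 <= t <= 1 -> A (g t)) in GA.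
  set (S := fun t => 0 <= t <= 1 /\ forall s, 0 <= s <= t -> U (g s)).
  destruct (completeness S) as [m [Hub Hl]].
  { exists 1. intros t [Ht _]. lra. }
  { exists 0. split; [lra|]. intros s Hs. replace s with 0 by lra. now rewrite G0. }
  assert (Hm0 : 0 <= m).
  { apply Hub. split; [lra|]. intros s Hs. replace s with 0 by lra. now rewrite G0. }
  assert (Hm1 : m <= 1) by (apply Hl; intros t [Ht _]; lra).
  assert (Below : forall s, 0 <= s < m -> U (g s)).
  { intros s Hs. apply NNPP. intros K.
    assert (m <= s); [|lra]. apply Hl. intros t [Ht Ut]. apply Rnot_lt_le. intros Hlt.
    apply K, Ut. lra. }
  assert (Loc : forall W : C -> Prop, open W -> W (g m) -> exists d, 0 < d /\ forall t, Rabs (t - m) < d -> W (g t)).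
  { intros W HW Wm. destruct (open_disc_C W (g m) HW Wm) as [e [He K]].
    destruct (Gc (RtoC m) e He) as [d [Hd K']]. exists d. split; auto. intros t Ht.
    apply K, K'. now rewrite <- RtoC_minus, Cmod_R. }
  destruct (Cov (g m) (GA m ltac:(lra))) as [Um|Vm].
  - destruct (Loc U HU Um) as [d [Hd HdU]].
    destruct (Req_dec m 1) as [->|Hm].
    + apply Dis. exists (g 1). rewrite G1 in *. auto.
    + assert (L1 := Rmin_l (d/2) (1 - m)). assert (L2 := Rmin_r (d/2) (1 - m)).
      assert (L3 : 0 < Rmin (d/2) (1 - m)) by (apply Rmin_pos; lra).
      assert (m + Rmin (d/2) (1 - m) <= m); [|lra].
      apply Hub. split; [lra|]. intros s Hs. destruct (Rlt_or_le s m); [apply Below; lra|].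
      apply HdU. rewrite Rabs_pos_eq; lra.
  - destruct (Loc V HV Vm) as [d [Hd HdV]].
    destruct (Req_dec m 0) as [->|Hm].
    + apply Dis. exists (g 0). rewrite G0 in *. auto.
    + assert (L1 := Rmax_l 0 (m - d/2)). assert (L2 := Rmax_r 0 (m - d/2)).
      assert (L3 : Rmax 0 (m - d/2) < m) by (apply Rmax_lub_lt; lra).
      set (s := Rmax 0 (m - d/2)) in *.
      apply Dis. exists (g s). split; [apply GA; lra|]. split; [apply Below; lra|].
      apply HdV. apply Rabs_def1; lra.
Qed.

Lemma open_ne (p : C) : open (fun z : C => z <> p).
Proof.
  intros z Hz. assert (N : (z - p)%C <> 0) by (intros E; now apply Hz, Ceq_sub0).
  assert (P := proj1 (Cmod_gt_0 _) N).
  assert (Pe : 0 < Cmod (z - p) / 2) by lra.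
  exists (mkposreal _ Pe). intros y Hy ->.
  apply (C_NormedModule_mixin_compat2 z p) in Hy. simpl in Hy.
  change (minus p z) with (p - z)%C in Hy. rewrite Cmod_sub_sym in Hy.
  assert (S2 : sqrt 2 < 2).
  { rewrite <- (sqrt_Rsqr 2) at 2 by lra. apply sqrt_lt_1; unfold Rsqr; lra. }
  nra.
Qed.

(** A one-parameter family of parabolic arcs from [z1] to [z2]. *)
Definition arch (z1 z2 : C) (lam : R) (z : C) : C :=
  (z1 + (z2 - z1) * (z + Ci * RtoC lam * (z * (1 - z))))%C.

(** In the coordinate where [z1, z2] become [0, 1] the arc is
    [t + i lam t (1 - t)]: the real part of [p] determines [t], and then the
    imaginary part determines [lam]. *)
Lemma arch_avoids (z1 z2 p : C) :
  z1 <> z2 -> p <> z1 -> p <> z2 ->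
  exists lam0, forall lam t, lam <> lam0 -> arch z1 z2 lam (RtoC t) <> p.
Proof.
  intros N N1 N2. assert (ND : (z2 - z1)%C <> 0) by (intros E; now apply N; rewrite (Ceq_sub0 _ _ E)).
  destruct ((p - z1) / (z2 - z1))%C as [a b] eqn:Eab.
  assert (Ep : p = (z1 + (z2 - z1) * (a, b))%C) by (rewrite <- Eab; field; auto).
  exists (b / (a * (1 - a))). intros lam t Hlam E. apply Hlam.
  assert (F : (RtoC t + Ci * RtoC lam * (RtoC t * (1 - RtoC t)))%C = (a, b)).
  { rewrite <- Eab, <- E. unfold arch. field; auto. }
  assert (Fa : t = a) by (apply (f_equal fst) in F; simpl in F; lra).
  assert (Fb : lam * (t * (1 - t)) = b) by (apply (f_equal snd) in F; simpl in F; lra).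
  subst t. rewrite <- Fb. field.
  split; intros Z.
  - apply N2. rewrite Ep. replace (a, b) with (RtoC 1); [ring|]. unfold RtoC. f_equal; nra.
  - apply N1. rewrite Ep. replace (a, b) with (RtoC 0); [ring|]. unfold RtoC. f_equal; nra.
Qed.

Lemma twice_punctured_domain (w1 w2 : C) : plane_domain (twice_punctured_plane w1 w2).
Proof.
  split; [|split].
  - assert (S : forall x : R, x <> 0 -> (w1 + RtoC x)%C <> w1).
    { intros x Hx E. apply Hx, RtoC_inj. replace (RtoC x) with (w1 + RtoC x - w1)%C by ring. rewrite E. ring. }
    destruct (excluded_middle_informative (w1 + RtoC 1 = w2)%C) as [E|E].
    + exists (w1 + RtoC 2)%C. split; [apply S; lra|]. rewrite <- E. intros E2.
      apply (S 1); [lra|]. replace (RtoC 1) with (RtoC 2 - RtoC 1)%C by (rewrite <- RtoC_minus; f_equal; lra).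
      replace (w1 + (RtoC 2 - RtoC 1))%C with (w1 + RtoC 2 - RtoC 1)%C by ring. rewrite E2. ring.
    + exists (w1 + RtoC 1)%C. split; [apply S; lra|auto].
  - apply open_and; apply open_ne.
  - apply connected_of_paths. intros z1 z2 [A1 A2] [B1 B2].
    destruct (excluded_middle_informative (z1 = z2)) as [->|N].
    { exists (fun _ => z2). do 2 (split; auto). split; [split; auto|]. intros. apply Ccont_const. }
    destruct (arch_avoids z1 z2 w1) as [l1 H1]; auto.
    destruct (arch_avoids z1 z2 w2) as [l2 H2]; auto.
    set (lam := Rabs l1 + Rabs l2 + 1).
    assert (Q1 := RRle_abs l1). assert (Q2 := RRle_abs l2).
    assert (Q3 := Rabs_pos l1). assert (Q4 := Rabs_pos l2).
    exists (arch z1 z2 lam). split; [unfold arch; ring|]. split; [unfold arch; ring|]. split.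
    + intros t _. split; [apply H1|apply H2]; unfold lam; lra.
    + intros z. apply Cderivable_cts. unfold arch.
      repeat first [apply Cderivable_id | apply Cderivable_const | apply Cderivable_minus | apply Cderivable_plus | apply Cderivable_mult | apply Cderivable_opp].
Qed.

Theorem corollary5p2 :
  (forall Om : C -> Prop, plane_domain Om -> hyperbolic Om ->
     forall w : C, Om w ->
       Rbar_le (Finite (hurwitz_density Om w / 16)) (hurwitz_density_bar Om w) /\
       Rbar_le (hurwitz_density_bar Om w) (Finite (hurwitz_density Om w))) /\
  ~ (exists c : R, c < 1 /\
       forall Om : C -> Prop, plane_domain Om -> hyperbolic Om ->
         forall w : C, Om w ->
           Rbar_le (hurwitz_density_bar Om w)
                   (Finite (c * hurwitz_density Om w))).
Proof.
  split.
  - intros Om [_ [Ho _]] Hh w Hw.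
    split; [now apply density_le_16_density_bar|now apply density_bar_le_density].
  - intros [c [Hc H]].
    assert (N01 : RtoC 0 <> RtoC 1) by (intros E; apply RtoC_inj in E; lra).
    set (Om := twice_punctured_plane 0 1).
    assert (Dom : plane_domain Om) by apply twice_punctured_domain.
    assert (O0 : ~ Om 0) by (intros [K _]; now apply K).
    assert (O1 : ~ Om 1) by (intros [_ K]; now apply K).
    destruct (proj1 Dom) as [w Hw].
    specialize (H Om Dom (ex_intro _ _ (ex_intro _ _ (conj N01 (conj O0 O1)))) w Hw).
    assert (L : Rbar_le (Finite (hurwitz_density Om w)) (hurwitz_density_bar Om w)).
    { apply (proj1 (Lub_Rbar_correct _)). exists (RtoC 0), (RtoC 1). auto. }
    assert (L' := Rbar_le_trans _ _ _ L H). simpl in L'.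
    destruct (open_disc_C Om w (proj1 (proj2 Dom)) Hw) as [d [Hd HD]].
    destruct (hurwitz_radius_finite Om w 0 d O0 Hd (hurwitz_derivative_of_disc Om w d Hd HD))
      as [rho [Hrho [_ [Eq _]]]].
    assert (0 < hurwitz_density Om w) by (rewrite Eq; apply Rdiv_lt_0_compat; lra).
    nra.
Qed.
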